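(* Given access to a value-prediction oracle with parameters $(\alpha,\beta)$ and constant $K$ of the second type (as defined in the context), there exists a one-pass streaming algorithm in the adjacency list model with space complexity $O\big(\frac{K}{\epsilon^2}(\alpha(\log n)^3\log\log n+m\beta/T)\big)$ that returns a $(1\pm\sqrt{K}\cdot\epsilon)$-approximation to $T$ with probability at least $7/10$.
   Context: $G=(V,E)$ is a simple undirected graph with $n$ vertices, $m$ edges and $T$ triangles; $0<\epsilon<1$. Adjacency list model: adjacency lists arrive contiguously one vertex at a time; $x<_s y$ means the list of $x$ arrives before that of $y$. For an edge $e=xy$, $R_e=|\{z:\{x,y,z\}\text{ is a triangle},\ x<_s z<_s y\}|$. A value-prediction oracle of the second type with parameters $(\alpha,\beta)$ outputs, for any edge $e$, a value $p(e)$ with $\Pr[p(e)>\lambda\alpha R_e+\beta]\le K/\lambda$ and $\Pr[p(e)<R_e/\lambda-\beta]\le K/\lambda$ for some constant $K$ and every $\lambda\ge1$. The algorithm may use a constant-factor approximation of $T$ to set parameters. *)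

(* Defs.v *)
From HB Require Import structures.
From mathcomp Require Import all_boot all_order all_algebra.
From mathcomp Require Import all_classical all_reals all_analysis.

Set Implicit Arguments.
Unset Strict Implicit.
Unset Printing Implicit Defensive.

Import Order.TTheory GRing.Theory Num.Theory.

Local Open Scope ring_scope.

Definition simple_graph (V : finType) (G : rel V) : Prop :=
  symmetric G /\ irreflexive G.

Definition edge (V : finType) (x y : V) : {set V} := [set x; y]%SET.

Definition edges (V : finType) (G : rel V) : {set {set V}} :=
  [set e : {set V} | [exists x, exists y, G x y && (e == edge x y)]]%SET.

Definition triangles (V : finType) (G : rel V) : {set {set V}} :=
  [set t : {set V} | (#|t| == 3%N) &&
     [forall x in t, forall y in t, (x != y) ==> G x y]]%SET.

(* An adjacency-list arrival order of G: [sigma] is the order in which the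
   vertices arrive, [adj x] the order of the neighbours inside the list of x. *)
Definition adj_order (V : finType) (G : rel V) (sigma : seq V)
    (adj : V -> seq V) : Prop :=
  perm_eq sigma (enum V) /\
  (forall x, perm_eq (adj x) [seq y <- enum V | G x y]).

(* Each edge xy occurs twice, as (x, y) in the list of x and as (y, x) in the
   list of y. *)
Definition adj_stream (V : finType) (sigma : seq V) (adj : V -> seq V) :
    seq (V * V) :=
  [seq (x, y) | x <- sigma, y <- adj x].

Definition arrives_before (V : finType) (sigma : seq V) (x y : V) : bool :=
  (index x sigma < index y sigma)%N.

(* R_e for the edge e = xy, where x is the endpoint arriving first *)
Definition Rcount (V : finType) (G : rel V) (sigma : seq V) (x y : V) : nat :=
  #|[set z : V | [&& edge x y :|: [set z] \in triangles G,
                     arrives_before sigma x z & arrives_before sigma z y]]%SET|.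

(* The oracle is one random function: p e is a random variable and asking twice
   about e gives the same value.  Nothing is assumed on the joint law of the
   values at different edges, nor on the values at non-edges. *)
Definition value_oracle2 (R : realType) (d : measure_display)
    (Omega : measurableType d) (P : probability Omega R) (V : finType)
    (G : rel V) (sigma : seq V) (alpha beta K : R)
    (p : {set V} -> {RV P >-> R}) : Prop :=
  forall x y : V, G x y -> arrives_before sigma x y ->
  forall lambda : R, 1 <= lambda ->
    (P [set w | (p (edge x y) w >
                 lambda * alpha * (Rcount G sigma x y)%:R + beta)%R]%classic
       <= (K / lambda)%:E)%E /\
    (P [set w | (p (edge x y) w <
                 (Rcount G sigma x y)%:R / lambda - beta)%R]%classic
       <= (K / lambda)%:E)%E.

(* A machine word: ceil(log2 n) bits, enough for one vertex identifier. *)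
Definition word (n : nat) := (up_log 2 n).-tuple bool.

(* A randomized one-pass algorithm.  The memory is a list of words; on each
   stream item (x, y) it is updated from the item, the oracle's value on the
   edge xy, and a fresh coin, uniform on a finite set.  Past items, oracle
   values and coins are available later only if stored in the memory.
   [sa_meas] makes every event about the run an event. *)
Record stream_alg (R : realType) (n : nat) := StreamAlg {
  sa_coin : nat;
  sa_init : seq (word n);
  sa_step : seq (word n) -> 'I_n * 'I_n -> R -> 'I_sa_coin.+1 -> seq (word n);
  sa_out : seq (word n) -> R;
  sa_meas : forall mem it coin mem',
    measurable [set v : R | sa_step mem it v coin = mem']%classic
}.

Section Run.
Variables (R : realType) (n : nat) (A : stream_alg R n).
Variables (p : {set 'I_n} -> R) (st : seq ('I_n * 'I_n)).
Variable coins : seq 'I_(sa_coin A).+1.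

Definition sa_trace : seq (seq (word n)) :=
  scanl (fun mem ic =>
           sa_step mem ic.1 (p (edge ic.1.1 ic.1.2)) ic.2)
        (sa_init A) (zip st coins).

Definition sa_space : nat :=
  (\max_(mem <- sa_init A :: sa_trace) size mem)%N.

Definition sa_result : R := sa_out A (last (sa_init A) sa_trace).
End Run.

Definition approximates (R : realType) (delta T est : R) : Prop :=
  (1 - delta) * T <= est <= (1 + delta) * T.

(* Probability that the result satisfies [good], for coins that are uniform,
   independent of each other and independent of the oracle: the average over
   all coin sequences of the probability over the oracle. *)
Definition sa_prob (R : realType) (d : measure_display)
    (Omega : measurableType d) (P : probability Omega R) (n : nat)
    (A : stream_alg R n) (p : {set 'I_n} -> {RV P >-> R})
    (st : seq ('I_n * 'I_n)) (good : R -> Prop) : \bar R :=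
  (((sa_coin A).+1%:R ^- size st)%:E *
   \sum_(coins : (size st).-tuple 'I_(sa_coin A).+1)
     P [set w | good (sa_result (fun e => p e w) st coins)]%classic)%E.

Definition space_bound (R : realType) (n m T : nat) (eps alpha beta K : R) : R :=
  K / eps ^+ 2 *
  (alpha * ln n%:R ^+ 3 * ln (ln n%:R) + m%:R * beta / T%:R).

(* Main.v *)
Require Import Defs.
From HB Require Import structures.
From mathcomp Require Import all_boot all_order all_algebra.
From mathcomp Require Import all_classical all_reals all_analysis.
From mathcomp Require Import zify ring lra.

Set Implicit Arguments.
Unset Strict Implicit.
Unset Printing Implicit Defensive.

Import Order.TTheory GRing.Theory Num.Theory.

Local Open Scope ring_scope.

(** The algorithm is importance sampling. With [a] of order [1 / (eps^2 T)], an
    edge [e] is sampled with probability about [a (beta + log n (p e - beta)^+)],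
    rounded to a power of two, at each of its two occurrences in the stream. A
    record created at the item (x, y) counts the later lists that contain both x
    and y, until the list of y arrives; it is discarded if that never happens, so
    that only the first occurrence of an edge contributes, and it contributes
    exactly R_e. Since the R_e add up to T, weighting each record by its inverse
    probability gives an unbiased estimate of T.

    The lower tail of the oracle bounds the expected variance by
    [6 (K + 1) T / a]: the factor [log n] absorbs the logarithm that its 1/lambda
    decay produces, and the term [beta] covers the smallest rates. The upper tail
    bounds the expected number of samples beyond the base rate. As m is not known
    in advance, the number of records is capped by a linear function of the number
    of items read; the cap is reached with small probability by a maximal
    inequality. Constant terms in the space are affordable because an oracle with
    given parameters exists only if [alpha + m beta / T] is not too small; the
    remaining case is that of an accuracy coarser than the factor [c] within which
    T is known, and then the estimate [Tapx] itself is returned. *)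

(** * Independent sampling with dyadic rates *)

Section CoinAverage.
Variables (R : realFieldType) (M : nat).
Implicit Types F H : seq 'I_M.+1 -> R.

(** Expectation over [L] independent uniform coins, by recursion on the first coin so that it
    follows inductions along the stream; [avg_sum_tuple] links it to the sum over coin tuples in
    [sa_prob]. *)
Fixpoint avg (L : nat) F : R :=
  if L is L'.+1 then M.+1%:R^-1 * \sum_x avg L' (fun s => F (x :: s))
  else F [::].

Lemma avg_sum_tuple L F :
  avg L F = M.+1%:R ^- L * \sum_(t : L.-tuple 'I_M.+1) F t.
Proof.
elim: L F => [|L IHL] F /=.
  rewrite expr0 invr1 mul1r (big_pred1 [tuple]) // => t.
  by apply/esym/eqP/val_inj; case: t => -[].
rewrite exprS invfM -mulrA; congr (_ * _).
rewrite (reindex (fun p : 'I_M.+1 * L.-tuple 'I_M.+1 => [tuple of p.1 :: p.2])) /=;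
  last first.
  exists (fun t : L.+1.-tuple 'I_M.+1 => (thead t, [tuple of behead t])).
    by move=> [x t] _ /=; rewrite theadE; congr (_, _); apply: val_inj.
  by move=> t _ /=; rewrite -tuple_eta.
rewrite -(pair_bigA _ (fun x (t : L.-tuple 'I_M.+1) => F (x :: t))) /=.
by rewrite mulr_sumr; apply: eq_bigr => x _; rewrite IHL.
Qed.

Lemma avg_le L F H : (forall s, size s = L -> F s <= H s) -> avg L F <= avg L H.
Proof.
elim: L F H => [|L IHL] F H FH /=; first exact: FH.
rewrite ler_wpM2l ?invr_ge0 ?ler0n //; apply: ler_sum => x _.
by apply: IHL => s sz; apply: FH; rewrite /= sz.
Qed.

Lemma avg_ext L F H : (forall s, size s = L -> F s = H s) -> avg L F = avg L H.
Proof. by move=> FH; apply/le_anti; rewrite !avg_le // => s /FH ->. Qed.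

Lemma avgD L F H : avg L (fun s => F s + H s) = avg L F + avg L H.
Proof.
elim: L F H => [|L IHL] F H //=.
by rewrite -mulrDr -big_split; congr (_ * _); apply: eq_bigr => x _; rewrite IHL.
Qed.

Lemma avgZ L k F : avg L (fun s => k * F s) = k * avg L F.
Proof.
elim: L F => [|L IHL] F //=; rewrite [RHS]mulrCA [in RHS]mulr_sumr; congr (_ * _).
by apply: eq_bigr => x _; rewrite IHL.
Qed.

Lemma avg_cst L k : avg L (fun=> k) = k.
Proof.
elim: L => [|L IHL] //=.
rewrite (eq_bigr (fun=> k)) // sumr_const card_ord -[k *+ _]mulr_natl mulrA.
by rewrite mulVf ?mul1r // pnatr_eq0.
Qed.

Variable J : nat.
Hypothesis MJ : M.+1 = (2 ^ J)%N.

(** For [j <= J], exactly [2 ^ (J - j)] of the [2 ^ J] coin values accept, so the acceptance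
    probability is exactly [rate j]. *)
Definition sampled (j x : nat) : bool := (x < 2 ^ (J - j))%N.

Definition rate (j : nat) : R := 2^-1 ^+ j.

Lemma rate_gt0 j : 0 < rate j.
Proof. by rewrite exprn_gt0 ?invr_gt0 ?ltr0n. Qed.

Lemma rateS j : rate j.+1 = rate j / 2.
Proof. by rewrite /rate exprSr. Qed.

Lemma coin_mean j (h : bool -> R) : (j <= J)%N ->
  M.+1%:R^-1 * \sum_(x < M.+1) h (sampled j x) =
  (1 - rate j) * h false + rate j * h true.
Proof.
move=> jJ.
have cnt : \sum_(x < M.+1) (sampled j x)%:R = (2 ^ (J - j))%:R :> R.
  rewrite -natr_sum; congr (_%:R).
  rewrite -(big_mkord xpredT (fun x => sampled j x : nat)).
  have le2 : (2 ^ (J - j) <= M.+1)%N by rewrite MJ leq_exp2l // leq_subr.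
  rewrite (big_cat_nat (leq0n _) le2) /=.
  rewrite (@eq_big_nat _ _ _ _ _ _ (fun=> 1%N)); last first.
    by move=> i /andP[_ ilt]; rewrite /sampled ilt.
  rewrite (@eq_big_nat _ _ _ (2 ^ (J - j))%N _ _ (fun=> 0%N)); last first.
    by move=> i /andP[ige _]; rewrite /sampled ltnNge ige.
  by rewrite !sum_nat_const_nat subn0 muln1 muln0 addn0.
have -> : \sum_(x < M.+1) h (sampled j x) =
    \sum_(x < M.+1) (h false + (h true - h false) * (sampled j x)%:R).
  by apply: eq_bigr => x _; case: sampled => /=; ring.
rewrite big_split /= -mulr_sumr cnt sumr_const card_ord mulrDr.
rewrite -[h false *+ _]mulr_natl mulKf ?pnatr_eq0 //.
have -> : rate j = (2 ^ (J - j))%:R / M.+1%:R.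
  rewrite MJ !natrX /rate exprVn.
  have -> : 2 ^+ J = 2 ^+ (J - j) * 2 ^+ j :> R by rewrite -exprD subnK.
  by field; rewrite !expf_neq0 ?pnatr_eq0.
by field; rewrite ?nat1r ?pnatr_eq0.
Qed.

(** The Horvitz-Thompson estimator for a list of pairs (level, gain). *)
Fixpoint estimate (l : seq (nat * R)) (s : seq 'I_M.+1) : R :=
  match l, s with
  | (j, g) :: l', x :: s' =>
      (if sampled j x then g / rate j else 0) + estimate l' s'
  | _, _ => 0
  end.

Lemma estimate_mean l : all (fun p => p.1 <= J)%N l ->
  avg (size l) (estimate l) = \sum_(p <- l) p.2.
Proof.
elim: l => [|[j g] l IHl] /=; first by rewrite big_nil.
case/andP=> jJ lJ; rewrite big_cons /= -(IHl lJ).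
under eq_bigr do rewrite avgD avg_cst.
rewrite (coin_mean (fun b : bool => (if b then g / rate j else 0) + _) jJ).
by field; rewrite gt_eqF ?rate_gt0.
Qed.

(** Independent items have additive variances, and one item sampled at rate q contributes
    [g ^+ 2 * (q^-1 - 1)]. *)
Lemma estimate_var l : all (fun p => p.1 <= J)%N l ->
  avg (size l) (fun s => (estimate l s - \sum_(p <- l) p.2) ^+ 2) =
  \sum_(p <- l) p.2 ^+ 2 * ((rate p.1)^-1 - 1).
Proof.
elim: l => [|[j g] l IHl] /=; first by rewrite !big_nil subrr expr0n.
case/andP=> jJ lJ; rewrite !big_cons /= -(IHl lJ).
have mean := estimate_mean lJ.
set S := \sum_(p <- l) p.2 in IHl mean *.
pose V := avg (size l) (fun s => (estimate l s - S) ^+ 2).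
rewrite (eq_bigr (fun x : 'I_M.+1 =>
    ((if sampled j x then g / rate j else 0) - g) ^+ 2 + V)); last first.
  move=> x _; set y := (if _ then _ else _).
  (* In the expanded square the cross term averages to zero by [mean]. *)
  transitivity (avg (size l) (fun s => (y - g) ^+ 2 +
      (2 * (y - g) * (estimate l s + - S) + (estimate l s - S) ^+ 2))).
    by apply: avg_ext => s _; ring.
  by rewrite !avgD avg_cst avgZ avgD avg_cst mean subrr mulr0 add0r.
rewrite (coin_mean (fun b : bool => ((if b then g / rate j else 0) - g) ^+ 2 + V) jJ).
by rewrite -/V; field; rewrite gt_eqF ?rate_gt0.
Qed.

(* [overflow js s b]: at some prefix the number of samples exceeds [b] plus
   twice its expectation. *)
Fixpoint overflow (js : seq nat) (s : seq 'I_M.+1) (b : R) : bool :=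
  match js, s with
  | j :: js', x :: s' =>
      let b' := b + 2 * rate j - (sampled j x)%:R in
      (b' < 0) || overflow js' s' b'
  | _, _ => false
  end.

End CoinAverage.

(* Ville's inequality for the supermartingale exp((N - 2 E N) / 2). *)
Lemma overflow_prob (R : realType) (M J : nat) (js : seq nat) (b : R) :
  M.+1 = (2 ^ J)%N -> all (leq^~ J) js ->
  avg (size js) (fun s : seq 'I_M.+1 => (overflow J js s b)%:R) <= expR (- b / 2).
Proof.
move=> MJ; elim: js b => [|j js IHjs] b /=; first by rewrite expR_ge0.
case/andP=> jJ jsJ; set q := rate R j.
pose h (t : bool) := expR (- (b + 2 * q - t%:R) / 2).
(* [h] is the claimed bound at the updated slack; when that slack is negative the overflow has
   occurred and [h] is at least 1. *)
apply: (@le_trans _ _ (M.+1%:R^-1 * \sum_(x < M.+1) h (sampled J j x))).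
  rewrite ler_wpM2l ?invr_ge0 ?ler0n //; apply: ler_sum => x _.
  rewrite /h; set b' := b + _ - _; have [b'0|b'0] /= := ltP b' 0.
    by rewrite avg_cst -[leLHS]expR0 ler_expR; lra.
  exact: IHjs.
rewrite (coin_mean MJ h jJ) -/q /h.
have -> : - (b + 2 * q - true%:R) / 2 = - b / 2 + (- q + 2^-1) :> R.
  by rewrite /=; field.
have -> : - (b + 2 * q - false%:R) / 2 = - b / 2 + - q :> R.
  by rewrite /=; field.
rewrite !expRD mulrCA (mulrCA q) -mulrDr ler_piMr ?expR_ge0 //.
rewrite [q * _]mulrCA [(1 - q) * _]mulrC -mulrDr.
(* With this bound, (1 - q) + q e^(1/2) <= 1 + q <= e^q, and the compensating factor e^(-q) brings
   the one-step mean below 1. *)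
have sqrte : expR 2^-1 <= 2 :> R.
  have := @expR_ge1Dx R (- 2^-1).
  have e0 := expR_gt0 (2^-1 : R).
  by rewrite expRN -[leRHS]mul1r ler_pdivlMr //; lra.
have q0 : 0 < q by exact: rate_gt0.
have := @expR_ge1Dx R q; have := expR_gt0 q.
by rewrite expRN => eq0 qe; rewrite mulrC ler_pdivrMr // mul1r; nra.
Qed.

(** * Counting the triangles of a sampled edge *)

Section Records.
Variable n : nat.
Implicit Types (e it hc : 'I_n * 'I_n) (x y z : 'I_n).

(* The state [(h, c)] attached to a sampled item [e = (x, y)]: [c] counts the
   lists seen so far that contain both x and y, and [h] is the owner of the last
   list in which one of them was seen; [h = y] means that the list of y has
   arrived, after which the state is frozen. *)
Definition scan1 e hc it : 'I_n * 'I_n :=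
  if hc.1 == e.2 then hc
  else if it.1 == e.2 then (e.2, hc.2)
  else if (it.2 == e.1) || (it.2 == e.2) then
    if hc.1 == it.1 then (hc.1, insubd hc.2 hc.2.+1) else (it.1, hc.2)
  else hc.

Definition scan e hc (st : seq ('I_n * 'I_n)) : 'I_n * 'I_n :=
  foldl (scan1 e) hc st.

(** The list of x does not come back, so with [h = x] the first hit in a later list is never
    mistaken for a second one. [insubd e.1 0%N] is the zero of ['I_n]. *)
Definition scan_start e : 'I_n * 'I_n := (e.1, insubd e.1 0%N).

Definition scan_value e hc : nat := if hc.1 == e.2 then val hc.2 else 0%N.

Definition hits e (s : seq 'I_n) : nat :=
  count (fun w => (w == e.1) || (w == e.2)) s.

Lemma scan_cat e hc s t : scan e hc (s ++ t) = scan e (scan e hc s) t.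
Proof. exact: foldl_cat. Qed.

Lemma scan_closed e hc st : hc.1 = e.2 -> scan e hc st = hc.
Proof. by move=> h; elim: st => //= it st; rewrite /scan1 h eqxx. Qed.

Lemma scan_nohit e hc z s : z <> e.2 -> hits e s = 0%N ->
  scan e hc [seq (z, w) | w <- s] = hc.
Proof.
move=> /eqP/negPf zy; elim: s => //= w s IHs.
case wh: ((w == e.1) || (w == e.2)) => //= /IHs.
by rewrite /scan1 /= zy wh; case: ifP.
Qed.

(** Once [h] is the owner z of the current list, every hit counts; the bound by n keeps [insubd]
    from falling back to its default. *)
Lemma scan_second e z (c : 'I_n) s : z <> e.2 -> (c + hits e s < n)%N ->
  (scan e (z, c) [seq (z, w) | w <- s]).1 = z /\
  (scan e (z, c) [seq (z, w) | w <- s]).2 = (c + hits e s)%N :> nat.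
Proof.
move=> /eqP/negPf zy; elim: s c => [|w s IHs] c /=; first by rewrite addn0.
rewrite /scan1 /= zy; case: ifP => _ /=; last by rewrite add0n => /IHs.
rewrite eqxx addnCA add1n => cn.
have vc : insubd c c.+1 = c.+1 :> nat.
  by rewrite val_insubd (leq_ltn_trans _ cn) // ltnS leq_addr.
by have := IHs (insubd c c.+1); rewrite vc addSn => /(_ cn).
Qed.

(** The first hit of a list only stores its owner and the later ones increment the counter, hence
    the predecessor. With at most two hits, a list adds 1 exactly when it contains both
    endpoints. *)
Lemma scan_list e z hc s : z <> e.2 -> hc.1 <> e.2 -> hc.1 <> z ->
  (hc.2 + (hits e s).-1 < n)%N ->
  let hc' := scan e hc [seq (z, w) | w <- s] in
  (hc'.1 = hc.1 \/ hc'.1 = z) /\ hc'.2 = (hc.2 + (hits e s).-1)%N :> nat.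
Proof.
move=> zy hy hz; elim: s => [|w s IHs] /=; first by rewrite addn0; split=> //; left.
have /eqP/negPf zy' := zy; have /eqP/negPf hy' := hy; have /eqP/negPf hz' := hz.
rewrite /scan1 /= hy' zy'; case: ifP => _ /=; last by rewrite add0n => /IHs.
rewrite hz' => cn.
by have [-> ->] := scan_second zy cn; split=> //; right.
Qed.

Section Lists.
Variables (e : 'I_n * 'I_n) (adj : 'I_n -> seq 'I_n).
Hypothesis hits2 : forall z, (hits e (adj z) <= 2)%N.

Lemma scan_open hc s : uniq s -> e.2 \notin s -> hc.1 \notin s -> hc.1 <> e.2 ->
  (hc.2 + size s < n)%N -> (scan e hc (adj_stream s adj)).1 <> e.2.
Proof.
elim: s hc => [|z s IHs] hc //= /andP[zs us].
rewrite !inE !negb_or => /andP[/eqP yz ys] /andP[/eqP hz hs] hy; rewrite addnS => cn.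
rewrite /adj_stream /= -/(adj_stream s adj) scan_cat.
have k2 := hits2 z.
have [|h1 c1] := @scan_list e z hc (adj z) (nesym yz) hy hz; first by lia.
by apply: IHs => //; [case: h1 => -> | case: h1 => -> //; apply: nesym | rewrite c1;
    by apply: leq_ltn_trans cn; rewrite -addSn leq_add2r -addn1 leq_add2l; lia].
Qed.

Lemma scan_close hc s : uniq s -> e.2 \in s -> adj e.2 != [::] ->
  hc.1 \notin s -> hc.1 <> e.2 -> (hc.2 + size s < n)%N ->
  let hc' := scan e hc (adj_stream s adj) in
  hc'.1 = e.2 /\
  hc'.2 = (hc.2 + count (fun z => 1 < hits e (adj z)) (take (index e.2 s) s))%N :> nat.
Proof.
move=> + + adjy; elim: s hc => [|z s IHs] hc //= /andP[zs us].
rewrite !inE !negb_or => ys /andP[/eqP hz hs] hy; rewrite addnS => cn.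
rewrite /adj_stream /= -/(adj_stream s adj) scan_cat.
(* The first item of the list of y closes the record and [scan_closed] freezes it; [adjy] provides
   that item. *)
have [zy|/eqP zy] := eqVneq z e.2.
  rewrite zy /=; case: (adj e.2) adjy => //= w l _.
  have /eqP/negPf hy' := hy.
  by rewrite /scan1 /= hy' eqxx !(scan_closed (hc := (e.2, hc.2))) //= addn0.
have k2 := hits2 z.
have [|h1 c1] := @scan_list e z hc (adj z) zy hy hz; first by lia.
have {}ys : e.2 \in s by case/predU1P: ys => // /esym.
have [| | |-> ->] := IHs (scan e hc [seq (z, w) | w <- adj z]) us ys _ _ _.
- by case: h1 => ->.
- by case: h1 => ->.
- by rewrite c1; apply: leq_ltn_trans cn; rewrite -addSn leq_add2r -addn1 leq_add2l; lia.
by split=> //=; rewrite c1 -addnA; congr addn; congr addn; lia.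
Qed.

End Lists.
End Records.

(** * Adjacency list streams *)

Section AdjacencyStream.
Variables (n : nat) (G : rel 'I_n) (sigma : seq 'I_n) (adj : 'I_n -> seq 'I_n).
Hypotheses (sG : simple_graph G) (oG : adj_order G sigma adj).

Notation V := 'I_n.
Notation bef := (arrives_before sigma).
Notation st := (adj_stream sigma adj).

Let Gsym : symmetric G := proj1 sG.
Let Girr : irreflexive G := proj2 sG.

Lemma uniq_arrival : uniq sigma.
Proof. by rewrite (perm_uniq (proj1 oG)) enum_uniq. Qed.

Lemma mem_arrival x : x \in sigma.
Proof. by rewrite (perm_mem (proj1 oG)) mem_enum. Qed.

Lemma size_arrival : size sigma = n.
Proof. by rewrite (perm_size (proj1 oG)) size_enum_ord. Qed.

Lemma uniq_adj x : uniq (adj x).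
Proof. by rewrite (perm_uniq (proj2 oG x)) filter_uniq ?enum_uniq. Qed.

Lemma mem_adj x y : (y \in adj x) = G x y.
Proof. by rewrite (perm_mem (proj2 oG x)) mem_filter mem_enum andbT. Qed.

Lemma edge_neq x y : G x y -> x != y.
Proof. by apply: contraTneq => ->; rewrite Girr. Qed.

Lemma before_total x y : x != y -> bef x y || bef y x.
Proof.
rewrite /arrives_before -neq_ltn; apply: contraNneq => ixy.
by rewrite -(nth_index x (mem_arrival x)) ixy nth_index ?mem_arrival.
Qed.

Lemma before_asym x y : bef x y -> bef y x = false.
Proof. by move=> xy; apply/negbTE; rewrite -leqNgt ltnW. Qed.

Lemma before_neq x y : bef x y -> x != y.
Proof. by apply: contraTneq => ->; rewrite /arrives_before ltnn. Qed.

Lemma before_trans : transitive bef.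
Proof. by move=> y x z; exact: ltn_trans. Qed.

Lemma hits_adj x y z : x != y -> hits (x, y) (adj z) = (G z x + G z y)%N.
Proof.
move=> xy; rewrite -!mem_adj -!(count_uniq_mem _ (uniq_adj z)) /hits.
rewrite -count_predUI -[LHS]addn0; congr addn.
rewrite (@eq_count _ _ pred0) ?count_pred0 // => w /=.
by apply: contraNF xy => /andP[/eqP <- /eqP <-].
Qed.

Lemma triangle3 x y z : x != y -> x != z -> y != z ->
  (edge x y :|: [set z] \in triangles G)%SET = [&& G x y, G x z & G y z].
Proof.
move=> xy xz yz; rewrite inE /edge finset.setUC cardsU1 !inE cards2.
rewrite xy (eq_sym z) (negPf xz) (eq_sym z) (negPf yz) /=.
apply/forall_inP/idP => [tri|/and3P[Gxy Gxz Gyz] u].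
  have inxyz u v : u \in (z |: [set x; y])%SET -> v \in (z |: [set x; y])%SET ->
      u != v -> G u v.
    by move=> /tri/forall_inP tri2 /tri2/implyP.
  by rewrite !inxyz // !inE ?eqxx ?orbT.
rewrite !inE => ut; apply/forall_inP => v; rewrite !inE => vt; apply/implyP.
by case/or3P: ut => /eqP ->; case/or3P: vt => /eqP -> //; rewrite ?eqxx // Gsym.
Qed.

Definition gain x y : nat := if bef x y then Rcount G sigma x y else 0%N.

Lemma before_prefix s1 x s2 y : sigma = s1 ++ x :: s2 -> x != y ->
  bef x y = (y \in s2).
Proof.
move=> sE xy; have us := uniq_arrival; have := mem_arrival y.
rewrite /arrives_before sE in us *.
rewrite cat_uniq /= negb_or in us; case/and3P: us => us1 /andP[xs1 s12] /andP[xs2 us2].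
rewrite !index_cat (negPf xs1) /= eqxx addn0 (negPf xy) mem_cat inE eq_sym (negPf xy) /=.
case ys1: (y \in s1) => /=; last by move=> ->; rewrite addnS ltnS leq_addr.
move=> _; rewrite ltnNge ltnW ?index_mem //=; apply/esym; apply: contraNF s12 => ys2.
by apply/hasP; exists y.
Qed.

Lemma between_prefix s1 x s2 y z : sigma = s1 ++ x :: s2 -> y \in s2 ->
  bef x z && bef z y = (z \in take (index y s2) s2).
Proof.
move=> sE ys2.
have [<-|xz] := eqVneq x z.
  rewrite /arrives_before ltnn /=; apply/esym; apply: contraTF (uniq_arrival) => /mem_take xs2.
  by rewrite sE cat_uniq /= xs2 !andbF.
rewrite (before_prefix sE xz).
have [zs2|zs2] /= := boolP (z \in s2); last first.
  by apply/esym; apply: contraNF zs2 => /mem_take.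
rewrite in_take // /arrives_before.
have us := uniq_arrival; rewrite sE in us *.
rewrite cat_uniq /= negb_or in us; case/and3P: us => us1 /andP[xs1 s12] /andP[xs2 us2].
have ns1 u : u \in s2 -> (u \in s1 = false) * (x == u = false).
  move=> us; split; first by apply: contraNF s12 => us1'; apply/hasP; exists u.
  by apply: contraNF xs2 => /eqP ->.
by rewrite !index_cat /= !ns1 // ltn_add2l ltnS.
Qed.

(** If y arrives after x, the lists counted are those strictly between x and y that contain both,
    which are the vertices z of R_e. Otherwise the record stays open and its value is 0. *)
Lemma item_gain s1 x s2 y : sigma = s1 ++ x :: s2 -> G x y ->
  scan_value (x, y) (scan (x, y) (scan_start (x, y)) (adj_stream s2 adj)) = gain x y.
Proof.
move=> sE Gxy; have xy := edge_neq Gxy.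
have us := uniq_arrival; rewrite sE cat_uniq /= in us.
case/and4P: us => _ _ xs2 us2.
have c0 : (scan_start (x, y)).2 = 0%N :> nat.
  by rewrite val_insubd (leq_ltn_trans _ (ltn_ord x)).
have sz : ((scan_start (x, y)).2 + size s2 < n)%N.
  by rewrite c0 -[ltnRHS]size_arrival sE size_cat /= addnS ltnS leq_addl.
have h2 z : (hits (x, y) (adj z) <= 2)%N by rewrite hits_adj //; case: G; case: G.
rewrite /gain (before_prefix sE xy) /scan_value.
have /eqP nxy := xy.
case/boolP: (y \in s2) => ys2; last first.
  by have /eqP/negPf -> := @scan_open _ (x, y) adj h2 (scan_start (x, y)) _ us2 ys2 xs2 nxy sz.
have adjy : adj y != [::].
  by apply/eqP => ady; have := mem_adj y x; rewrite ady in_nil Gsym Gxy.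
have [/= -> ->] := @scan_close _ (x, y) adj h2 (scan_start (x, y)) _ us2 ys2 adjy xs2 nxy sz.
rewrite eqxx /= c0 add0n /Rcount -size_filter.
rewrite -(card_uniqP (filter_uniq _ (take_uniq _ us2))).
apply: eq_card => z; rewrite inE mem_filter -(between_prefix _ sE ys2).
rewrite hits_adj //.
case/boolP: (bef x z) => xz; rewrite /= ?andbF //.
case/boolP: (bef z y) => zy; rewrite /= ?andbF // !andbT.
have yz : y != z by rewrite eq_sym before_neq.
rewrite (triangle3 xy (before_neq xz) yz) Gxy (Gsym z x) (Gsym z y).
by case: (G x z); case: (G y z).
Qed.

(** Each entry depends only on the items still to come, the form needed for the induction along the
    stream in [sampler_run_out]. *)
Fixpoint gains (s : seq (V * V)) : seq nat :=
  if s is it :: s' then scan_value it (scan it (scan_start it) s') :: gains s'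
  else [::].

Lemma gains_stream : gains st = [seq gain it.1 it.2 | it <- st].
Proof.
suff gen s1 s2 : sigma = s1 ++ s2 ->
    gains (adj_stream s2 adj) = [seq gain it.1 it.2 | it <- adj_stream s2 adj].
  exact: (gen [::]).
elim: s2 s1 => [|x s2 IHs] s1 sE //.
rewrite /adj_stream /= -/(adj_stream s2 adj).
have {IHs} := IHs (rcons s1 x); rewrite cat_rcons => /(_ sE) IHs.
suff gen2 a1 a2 : adj x = a1 ++ a2 ->
    gains ([seq (x, y) | y <- a2] ++ adj_stream s2 adj) =
    [seq gain it.1 it.2 | it <- [seq (x, y) | y <- a2] ++ adj_stream s2 adj].
  exact: (gen2 [::]).
elim: a2 a1 => [|y a2 IHa] a1 aE //=.
rewrite (IHa (rcons a1 y)) ?cat_rcons //; congr (_ :: _).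
have Gxy : G x y by rewrite -mem_adj aE mem_cat inE eqxx orbT.
have xy := edge_neq Gxy.
(* The rest of the list of x contains neither x nor a second copy of y, so scanning it leaves the
   record unchanged. *)
rewrite scan_cat scan_nohit; first exact: (item_gain sE).
  exact/eqP.
have := hits_adj x xy; rewrite Girr Gxy aE /hits count_cat /= eqxx orbT /=; lia.
Qed.

Lemma sum_stream (S : nmodType) (F : V -> V -> S) :
  \sum_(it <- st) F it.1 it.2 = \sum_x \sum_(y | G x y) F x y.
Proof.
rewrite big_allpairs_dep (perm_big _ (proj1 oG)) big_enum; apply: eq_bigr => x _.
by rewrite (perm_big _ (proj2 oG x)) big_filter big_enum_cond.
Qed.

(** * Triangles as triples sorted by arrival *)

Lemma sorted3_fst (a b c a' b' c' : nat) :
  (a < c -> c < b -> a' < c' -> c' < b' ->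
   [|| a == a', a == b' | a == c'] -> [|| a' == a, a' == b | a' == c] -> a == a')%N.
Proof.
move=> ac cb ac' cb' /or3P[]/eqP h1 /or3P[]/eqP h2; apply/eqP;
  clear -ac cb ac' cb' h1 h2; lia.
Qed.

Lemma sorted3_snd (a b c a' b' c' : nat) :
  (a < c -> c < b -> a' < c' -> c' < b' ->
   [|| b == a', b == b' | b == c'] -> [|| b' == a, b' == b | b' == c] -> b == b')%N.
Proof.
move=> ac cb ac' cb' /or3P[]/eqP h1 /or3P[]/eqP h2; apply/eqP;
  clear -ac cb ac' cb' h1 h2; lia.
Qed.

Lemma sorted3_mid (a b c c' : nat) :
  (a < c -> c < b -> [|| c == a, c == b | c == c'] -> c == c')%N.
Proof. by move=> ac cb /or3P[]/eqP h; apply/eqP; clear -ac cb h; lia. Qed.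

Definition sorted_triples : {set V * V * V} :=
  [set t : V * V * V | [&& G t.1.1 t.1.2, G t.1.1 t.2, G t.1.2 t.2,
     bef t.1.1 t.2 & bef t.2 t.1.2]]%SET.

(** A triangle has exactly one labelling with x before z before y: the vertex set determines its
    first, last and middle element in arrival order. *)
Lemma card_sorted_triples : #|sorted_triples| = #|triangles G|.
Proof.
pose f (t : V * V * V) := (edge t.1.1 t.1.2 :|: [set t.2])%SET.
have finj : {in sorted_triples &, injective f}.
  move=> [[x y] z] [[x' y'] z'] /=; rewrite !inE /=.
  move=> /and5P[_ _ _ xz zy] /and5P[_ _ _ xz' zy'] /setP ff.
  have ff' u : [|| u == x, u == y | u == z] = [|| u == x', u == y' | u == z'].
    by have := ff u; rewrite !inE /= -!orbA.
  have ix u v : (u == v) = (index u sigma == index v sigma) :> bool.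
    apply/eqP/eqP => [->//|uv].
    by rewrite -(nth_index u (mem_arrival u)) uv nth_index ?mem_arrival.
  have hx : [|| x == x', x == y' | x == z'] by rewrite -ff' eqxx.
  have hx' : [|| x' == x, x' == y | x' == z] by rewrite ff' eqxx.
  have hy : [|| y == x', y == y' | y == z'] by rewrite -ff' eqxx orbT.
  have hy' : [|| y' == x, y' == y | y' == z] by rewrite ff' eqxx orbT.
  have hz : [|| z == x', z == y' | z == z'] by rewrite -ff' eqxx !orbT.
  rewrite /arrives_before in xz zy xz' zy'.
  move: hx hx' hy hy' hz; rewrite !ix => hx hx' hy hy' hz.
  have /eqP xx : x == x' by rewrite ix; apply: sorted3_fst xz zy xz' zy' hx hx'.
  have /eqP yy : y == y' by rewrite ix; apply: sorted3_snd xz zy xz' zy' hy hy'.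
  rewrite -xx -yy in hz *; congr (_, _, _); apply/eqP; rewrite ix.
  exact: sorted3_mid xz zy hz.
rewrite -(card_in_imset finj); congr #|pred_of_set _|; apply/setP => t.
apply/imsetP/idP => [[[[x y] z]]|].
  rewrite inE /= => /and5P[Gxy Gxz Gyz xz zy] ->.
  by rewrite triangle3 ?Gxy ?Gxz ?Gyz // ?edge_neq.
move=> tT; move: (tT); rewrite inE => /andP[/eqP t3 _].
have [x tx] : exists x, x \in t by apply/card_gt0P; rewrite t3.
have t2 : #|t :\ x|%SET = 2%N by move: t3; rewrite (cardsD1 x) tx => -[].
have [y ty] : exists y, y \in (t :\ x)%SET by apply/card_gt0P; rewrite t2.
have t1 : #|t :\ x :\ y|%SET == 1%N by move: t2; rewrite (cardsD1 y) ty add1n => -[->].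
have [z tz] := cards1P t1.
have tE : t = [set x; y; z]%SET.
  apply/setP => u; have /setP/(_ u) := tz; rewrite !inE.
  move: ty; rewrite !inE => /andP[_ ty].
  case: (eqVneq u x) => [->|] //=; case: (eqVneq u y) => [->|] //=.
have zt : z \in (t :\ x :\ y)%SET by rewrite tz inE.
move: zt ty; rewrite !inE => /and3P[zy zx _] /andP[yx _].
have wl a b c : a != b -> a != c -> b != c -> t = [set a; b; c]%SET ->
    bef a c -> bef c b -> exists2 p, p \in sorted_triples & t = f p.
  move=> ab ac bc tabc hac hcb; exists (a, b, c) => //.
  by rewrite inE /= hac hcb !andbT; move: tT; rewrite tabc triangle3.
have perm2 (a b c : V) : ([set a; b; c] = [set b; a; c])%SET.
  by rewrite (finset.setUC [set a]%SET).
have perm3 (a b c : V) : ([set a; b; c] = [set a; c; b])%SET.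
  by rewrite -!finset.setUA (finset.setUC [set b]%SET).
(* Of the eight sign patterns of the three comparisons, six are the orders of the vertices and two
   are cyclic, excluded by transitivity. *)
have /orP[xy|xy] := before_total (x := x) (y := y) (ltac:(by rewrite eq_sym));
have /orP[hxz|hxz] := before_total (x := x) (y := z) (ltac:(by rewrite eq_sym));
have /orP[yz|yz] := before_total (x := y) (y := z) (ltac:(by rewrite eq_sym)).
- by apply: (wl x z y) => //; rewrite 1?eq_sym // perm3.
- by apply: (wl x y z) => //; rewrite 1?eq_sym.
- by have := before_trans xy yz; rewrite (before_asym hxz).
- by apply: (wl z y x) => //; rewrite 1?eq_sym // tE perm3 perm2 perm3.
- by apply: (wl y z x) => //; rewrite 1?eq_sym // tE perm2 perm3.
- by have := before_trans hxz yz; rewrite (before_asym xy).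
- by apply: (wl y x z) => //; rewrite 1?eq_sym // tE perm2.
- by apply: (wl z x y) => //; rewrite 1?eq_sym // tE perm3 perm2.
Qed.

Lemma sum_gain : (\sum_x \sum_(y | G x y) gain x y)%N = #|triangles G|.
Proof.
rewrite -card_sorted_triples -sum1_card.
rewrite [RHS](eq_bigl (fun t => xpredT t.1 && ((t.1, t.2) \in sorted_triples))) /=;
  last by case.
rewrite -(pair_big_dep xpredT (fun p z => (p, z) \in sorted_triples) (fun _ _ => 1%N)) /=.
rewrite (eq_bigr (fun p => \sum_(z | (p.1, p.2, z) \in sorted_triples) 1)%N); last by case.
rewrite -(pair_bigA _ (fun x y => \sum_(z | (x, y, z) \in sorted_triples) 1)%N) /=.
apply: eq_bigr => x _; rewrite big_mkcond; apply: eq_bigr => y _.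
rewrite sum1_card /gain; case: ifP => Gxy; last first.
  by apply/esym/eq_card0 => z; rewrite -[LHS]/((x, y, z) \in sorted_triples) inE /= Gxy.
case: ifP => xy; last first.
  apply/esym/eq_card0 => z; rewrite -[LHS]/((x, y, z) \in sorted_triples) inE /=.
  by apply/negP => /and5P[_ _ _ xz /(before_trans xz)]; rewrite xy.
apply: eq_card => z; rewrite -[RHS]/((x, y, z) \in sorted_triples) !inE /= Gxy /=.
case/boolP: (bef x z) => xz; rewrite /= ?andbF //.
case/boolP: (bef z y) => zy; rewrite /= ?andbF // !andbT.
have zy' : y != z by rewrite eq_sym before_neq.
by have := triangle3 (before_neq xy) (before_neq xz) zy'; rewrite inE Gxy => ->.
Qed.

Definition oriented_edges : {set V * V} :=
  [set p : V * V | G p.1 p.2 && bef p.1 p.2]%SET.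

Lemma card_oriented_edges : (#|oriented_edges| <= #|edges G|)%N.
Proof.
have inj : {in oriented_edges &, injective (fun p : V * V => edge p.1 p.2)}.
  move=> [x y] [x' y']; rewrite !inE /= => /andP[_ xy] /andP[_ xy'] /setP ee.
  have := ee x; have := ee y; rewrite !inE !eqxx orbT /=.
  have nxy := before_neq xy; have asym := before_asym xy.
  case/esym/orP => /eqP yE; case/esym/orP => /eqP xE; rewrite xE yE //.
  - by rewrite xE yE eqxx in nxy.
  - by rewrite xE yE xy' in asym.
  - by rewrite xE yE eqxx in nxy.
rewrite -(card_in_imset inj) subset_leq_card //; apply/fintype.subsetP => e.
case/imsetP=> -[x y]; rewrite !inE /= => /andP[Gxy _] ->.
by apply/existsP; exists x; apply/existsP; exists y; rewrite Gxy eqxx.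
Qed.

Lemma sum_sym (S : nmodType) (F : V -> V -> S) : (forall x y, F x y = F y x) ->
  \sum_x \sum_(y | G x y) F x y =
  (\sum_x \sum_(y | G x y) (if bef x y then F x y else 0)) *+ 2.
Proof.
move=> Fsym; rewrite mulr2n.
rewrite [X in _ = _ + X](exchange_big_dep xpredT) //= -big_split /=.
apply: eq_bigr => x _; rewrite [X in _ + X](eq_bigl (G x)) => [|y]; last by rewrite Gsym.
rewrite -big_split /=; apply: eq_bigr => y Gxy; rewrite (Fsym y x).
case: ifP => [xy|xy]; first by rewrite before_asym // addr0.
by have := before_total (edge_neq Gxy); rewrite xy => /= ->; rewrite add0r.
Qed.

Lemma size_stream : size st = (2 * #|oriented_edges|)%N.
Proof.
rewrite -sum1_size (sum_stream (fun _ _ => 1%N)) (sum_sym (F := fun _ _ => 1%N)) //.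
rewrite mulr2n -[LHS]/(_ + _)%N addnn -mul2n; congr (2 * _)%N.
rewrite -sum1_card [RHS](eq_bigl (fun p => G p.1 p.2 && bef p.1 p.2)); last first.
  by move=> p; rewrite inE.
rewrite -(pair_big_dep xpredT (fun x y => G x y && bef x y) (fun _ _ => 1%N)) /=.
by apply: eq_bigr => x _; rewrite big_mkcondr.
Qed.

Lemma size_stream_edges : (size st <= 2 * #|edges G|)%N.
Proof. by rewrite size_stream leq_mul2l card_oriented_edges. Qed.

Lemma size_stream_sqr : (size st <= n * n)%N.
Proof.
rewrite -sum1_size (sum_stream (fun _ _ => 1%N)).
have -> : (n * n)%N = (\sum_(x < n) n)%N by rewrite sum_nat_const card_ord.
apply: leq_sum => x _; rewrite sum1_card.
by apply: leq_trans (max_card _) _; rewrite card_ord.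
Qed.

End AdjacencyStream.

(** * The streaming algorithm *)

Section Sampler.
Variables (R : realType) (n J M : nat) (B gam : R).

Notation item := ('I_n * 'I_n)%type.

(* sampled item, scanning state, level *)
Definition record : Type := (item * item * 'I_J.+1)%type.

(* number of items read (capped by the type, never exceeded) and records kept *)
Definition state : Type := ('I_(n * n).+1 * seq record)%type.

Definition advance (it : item) (r : record) : record :=
  (r.1.1, scan1 r.1.1 r.1.2 it, r.2).

Definition sampler_step (s : state) (it : item) (j : 'I_J.+1) (x : 'I_M.+1) :
    state :=
  (inord s.1.+1,
   if sampled J j x && ((size s.2).+1%:R <= B + gam * s.1.+1%:R) then
     (it, scan_start it, j) :: map (advance it) s.2
   else map (advance it) s.2).

Definition sampler_out (s : state) : R :=
  \sum_(r <- s.2) (scan_value r.1.1 r.1.2)%:R / rate R r.2.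

Definition sampler_init : state := (ord0, [::]).

Variable lev : item -> 'I_J.+1.
Implicit Types (s : state) (st : seq item) (cs : seq 'I_M.+1).

Definition sampler_run (s : state) (st : seq item) (cs : seq 'I_M.+1) : state :=
  foldl (fun s ic => sampler_step s ic.1 (lev ic.1) ic.2) s (zip st cs).

(** The test in [sampler_step] makes the cap an invariant of every run, so the space bound holds for
    all coins and oracle values. *)
Lemma sampler_run_size s st cs : 0 <= gam -> (s.1 + size st <= n * n)%N ->
  (size s.2)%:R <= B + gam * s.1%:R ->
  let s' := sampler_run s st cs in
  (s'.1 <= s.1 + size st)%N /\ (size s'.2)%:R <= B + gam * s'.1%:R.
Proof.
move=> gam0; elim: st cs s => [|it st IHst] [|x cs] s /= szt szs;
  rewrite ?addn0 ?leq_addr //.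
have t1 : val (sampler_step s it (lev it) x).1 = s.1.+1.
  by rewrite /= inordK // ltnS; apply: leq_trans szt; rewrite addnS ltnS leq_addr.
have [||le1 le2] := IHst cs (sampler_step s it (lev it) x).
- by rewrite t1 addSnnS.
- rewrite t1 /sampler_step /=; case: ifP => [/andP[_ le]|_] /=; rewrite size_map //.
  by rewrite (le_trans szs) // lerD2l ler_wpM2l // ler_nat.
by split=> //; rewrite addnS -addSn -t1.
Qed.

Definition advance_all (st : seq item) (r : record) : R :=
  (scan_value r.1.1 (scan r.1.1 r.1.2 st))%:R / rate R r.2.

Definition level_gains (st : seq item) : seq (nat * R) :=
  zip [seq val (lev it) | it <- st] [seq g%:R | g <- gains st].

(* [d j] is the part of the rate of level j above the base rate. *)
Variables (d : nat -> R) (rho : R).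
Hypothesis d_ge0 : forall j, 0 <= d j.
Hypothesis rate_split : forall j, rate R j <= rho + d j.

(** Without overflow the cap refuses no sample, and the output is the pure estimator. The invariant
    keeps the records and the slack [b] under the cap after reserving twice the excess of the items
    to come: of each new allowance [2 * rate], the growth [gam = 2 * rho] pays the base part and the
    reserve pays the rest. *)
Lemma sampler_run_out s st cs b : gam = 2 * rho -> size cs = size st ->
  (s.1 + size st <= n * n)%N ->
  ~~ overflow J [seq val (lev it) | it <- st] cs b ->
  (size s.2)%:R + b <= B + gam * s.1%:R - 2 * \sum_(it <- st) d (lev it) ->
  sampler_out (sampler_run s st cs) =
  \sum_(r <- s.2) advance_all st r + estimate J (level_gains st) cs.
Proof.
move=> gamE; elim: st cs s b => [|it st IHst] [|x cs] s b //=.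
  by move=> *; rewrite addr0; apply: eq_bigr.
move=> [szc] szt; rewrite negb_or -leNgt => /andP[b0 nover]; rewrite big_cons => room.
set s1 := sampler_step s it (lev it) x.
have t1 : val s1.1 = s.1.+1.
  by rewrite /= inordK // ltnS; apply: leq_trans szt; rewrite addnS ltnS leq_addr.
have D0 : 0 <= \sum_(it <- st) d (lev it) by exact: sumr_ge0.
have rs := rate_split (lev it).
set D := \sum_(it <- st) d (lev it) in D0 room.
have room1 : (size s.2)%:R + (sampled J (lev it) x)%:R +
    (b + 2 * rate R (lev it) - (sampled J (lev it) x)%:R) <=
    B + gam * s.1.+1%:R - 2 * D.
  by rewrite -natr1 gamE; rewrite gamE in room; lra.
have s1E : s1.2 = if sampled J (lev it) x then
    (it, scan_start it, lev it) :: map (advance it) s.2 else map (advance it) s.2.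
  rewrite /s1 /sampler_step /=; case smp: sampled room1 b0 => //= room1 b0.
  by rewrite ifT // -natr1; lra.
have szs1 : (size s1.2)%:R = (size s.2)%:R + (sampled J (lev it) x)%:R :> R.
  by rewrite s1E; case: sampled; rewrite /= size_map ?addr0 // -addn1 natrD.
have -> : sampler_run s (it :: st) (x :: cs) = sampler_run s1 st cs by [].
rewrite (IHst cs s1 _ szc _ nover); first last.
- by rewrite t1 szs1.
- by rewrite t1 addSnnS.
rewrite s1E /=; case: sampled; rewrite ?big_cons big_map.
  by rewrite -addrA [RHS]addrCA.
by rewrite add0r.
Qed.

End Sampler.

(** * Encoding finite data in blocks of memory words *)

Section Encoding.
Variables (T W : finType) (k : nat).
Hypothesis card_TW : (#|T| <= #|W| ^ k)%N.

Fact encode_sub : (#|T| <= #|{: k.-tuple W}|)%N.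
Proof. by rewrite card_tuple. Qed.

Definition encode (x : T) : k.-tuple W :=
  enum_val (widen_ord encode_sub (enum_rank x)).

Definition decode (w : k.-tuple W) : option T :=
  omap enum_val (insub (val (enum_rank w)) : option 'I_#|T|).

Lemma encodeK : pcancel encode decode.
Proof.
move=> x; rewrite /decode /encode enum_valK /= insubT ?ltn_ord //= => lt.
by congr Some; rewrite -[RHS]enum_rankK; congr enum_val; apply: val_inj.
Qed.

Definition encode_seq (s : seq T) : seq W := flatten [seq val (encode x) | x <- s].

Fixpoint decode_seq (m : nat) (w : seq W) : seq T :=
  if m is m'.+1 then
    match insub (take k w) : option (k.-tuple W) with
    | Some t => if decode t is Some x then x :: decode_seq m' (drop k w) else [::]
    | None => [::]
    end
  else [::].

Lemma size_encode_seq s : size (encode_seq s) = (k * size s)%N.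
Proof.
elim: s => [|x s IHs] /=; first by rewrite muln0.
by rewrite size_cat size_tuple IHs mulnS.
Qed.

Lemma encode_seqK s : decode_seq (size s) (encode_seq s) = s.
Proof.
elim: s => //= x s IHs; rewrite take_cat drop_cat size_tuple ltnn subnn take0 drop0 cats0.
by rewrite valK /= encodeK IHs.
Qed.

End Encoding.

(** The set is a countable union over the value of the first function, by induction on the list;
    [Phi] can therefore be arbitrary. *)
Lemma measurable_map (d : measure_display) (T : measurableType d) (I : Type)
    (f : I -> T -> nat) (s : seq I) (Phi : seq nat -> Prop) :
  (forall i k, measurable [set w | f i w = k]%classic) ->
  measurable [set w | Phi [seq f i w | i <- s]]%classic.
Proof.
move=> mf; elim: s Phi => [|i s IHs] Phi /=.
  by have [p|p] := pselect (Phi [::]); [rewrite (_ : mkset _ = setT) |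
    rewrite (_ : mkset _ = set0)] => //; apply/seteqP; split.
rewrite (_ : mkset _ = (\bigcup_k ([set w | f i w = k] `&`
    [set w | Phi (k :: [seq f i w | i <- s])]))%classic); last first.
  by apply/seteqP; split=> w /= => [Pw|[k _ [<-]]//]; exists (f i w).
apply: bigcupT_measurable => k; apply: measurableI; first exact: mf.
exact: (IHs (fun t => Phi (k :: t))).
Qed.

(** * From oracle values to sampling levels *)

Section Levels.
Variables (R : realType) (J : nat) (a beta : R).

Definition below (k : nat) (v : R) : bool :=
  (a * beta <= rate R k.+1) && (v <= beta + rate R k.+1 / (a * J%:R)).

(* The rate of [level v] is the least power of 1/2, down to [2^-J], that is at
   least [a * beta] and [a * J * (v - beta)]. *)
Definition level (v : R) : nat := find (fun k => ~~ below k v) (iota 0 J).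

Lemma level_le v : (level v <= J)%N.
Proof. by rewrite -[leqRHS](size_iota 0 J) find_size. Qed.

Lemma level_above v : (level v < J)%N -> ~~ below (level v) v.
Proof.
move=> lJ; have := lJ; rewrite -[ltnRHS](size_iota 0 J) -has_find.
by move/(nth_find 0%N); rewrite nth_iota.
Qed.

Lemma level_below v k : level v = k.+1 -> below k v.
Proof.
move=> lv; have kl : (k < level v)%N by rewrite lv.
have kJ : (k < J)%N by apply: leq_trans (level_le v).
by have := before_find 0%N kl; rewrite nth_iota // => /negbFE.
Qed.

Definition olevel (v : R) : 'I_J.+1 := Ordinal (level_le v : (level v < J.+1)%N).

Lemma measurable_olevel (Phi : 'I_J.+1 -> Prop) :
  measurable [set v : R | Phi (olevel v)]%classic.
Proof.
pose f (k : nat) (v : R) : nat := below k v.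
pose Psi (s : seq nat) := Phi (inord (find (fun b => b == 0)%N s)).
have levE v : olevel v = inord (find (fun b => b == 0)%N [seq f k v | k <- iota 0 J]).
  apply: val_inj; rewrite find_map /= inordK; last first.
    by rewrite ltnS -[leqRHS](size_iota 0 J) find_size.
  by apply: eq_find => k /=; rewrite /f eqb0.
have -> : [set v | Phi (olevel v)]%classic =
    [set v | Psi [seq f k v | k <- iota 0 J]]%classic.
  by apply/seteqP; split=> v /=; rewrite /Psi -levE.
refine (measurable_map (f := f) (iota 0 J) Psi _) => k [|[|m]] /=; last first.
- rewrite (_ : mkset _ = set0) //; apply/seteqP; split=> v //=.
  by rewrite /f; case: below.
all: have m1 : measurable [set v : R | below k v]%classic.
1,3: rewrite /below; case: (a * beta <= _); last first.
1,3: by rewrite (_ : mkset _ = set0) //; apply/seteqP; split.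
1,2: rewrite (_ : mkset _ = `]-oo, (beta + rate R k.+1 / (a * J%:R))]%classic).
1,3: exact: measurable_itv.
1,2: by apply/seteqP; split=> v /=; rewrite in_itv.
- rewrite (_ : mkset _ = [set v : R | below k v]%classic) //.
  by apply/seteqP; split=> v /=; rewrite /f; case: below.
- rewrite (_ : mkset _ = ~` [set v : R | below k v])%classic; first exact: measurableC.
  by apply/seteqP; split=> v /=; rewrite /f; case: below => //= /(_ isT).
Qed.

End Levels.

Lemma foldl_scanl (A T : eqType) (g : A -> T -> A) (x y : A) (s : seq T) :
  y \in x :: scanl g x s -> exists i, y = foldl g x (take i s).
Proof.
move=> /(nthP x)[i]; rewrite /= size_scanl ltnS => ile <-.
by exists i; rewrite nth_cons_scanl.
Qed.

Lemma last_scanl (A T : Type) (g : A -> T -> A) (x : A) (s : seq T) :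
  last x (scanl g x s) = foldl g x s.
Proof. by elim: s x => //= y s IHs x. Qed.

Lemma take_zip (A T : Type) (s : seq A) (t : seq T) i :
  take i (zip s t) = zip (take i s) (take i t).
Proof. by elim: s t i => [|x s IHs] [|y t] [|i] //=; rewrite IHs. Qed.

(** Chosen so that [2 ^ depth n] is at least [n * n], hence at least the stream length: at the
    lowest rate the whole stream yields at most one expected sample. *)
Definition depth (n : nat) : nat := (2 * up_log 2 n)%N.

Definition coin_max (n : nat) : nat := (2 ^ depth n).-1.

(** * The sampler as a [stream_alg], and its memory *)

Section Algorithm.
Variables (R : realType) (n : nat) (a beta B gam : R).

Notation J := (depth n).
Notation M := (coin_max n).

Lemma coins_pow2 : M.+1 = (2 ^ J)%N.
Proof. by rewrite prednK // expn_gt0. Qed.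

Lemma sqr_le_coins : (n * n <= 2 ^ J)%N.
Proof. by rewrite /depth mulnC expnM mulnn leq_exp2r // up_logP. Qed.

(** One type for the item counter and the records, so that memory consists of blocks of equal
    length. *)
Definition cell : finType := ('I_(n * n).+1 + record n J)%type.

(** Four vertices take four words and a level at most two; the seventh word leaves room for the
    disjoint sum with the counter. *)
Lemma card_cell : (2 < n)%N -> (#|cell| <= #|{: word n}| ^ 7)%N.
Proof.
move=> n3; rewrite card_sum !card_prod !card_ord card_tuple card_bool.
have := up_logP n (isT : 1 < 2)%N; have := ltn_expl (up_log 2 n) (isT : 1 < 2)%N.
rewrite /depth; set W := (2 ^ up_log 2 n)%N; move: (up_log 2 n) => w wW nW.
have W2 : (2 < W)%N by exact: leq_trans nW.
have nn : (n * n <= W * W)%N by rewrite leq_mul.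
have h1 : (n * n * (n * n) * (2 * w).+1 <= W * W * (W * W) * (W * W))%N.
  by rewrite leq_mul ?leq_mul //; nia.
have -> : (W ^ 7 = W * (W * W * (W * W) * (W * W)))%N by rewrite !expnS expn0; lia.
have : (0 < W * W)%N by nia.
move: h1 nn; set X := (W * W)%N => h1 nn X0.
have h2 : (X + 1 <= X * X * X + 1)%N by rewrite leq_add2r -mulnA leq_pmulr // muln_gt0 X0.
nia.
Qed.

Hypothesis n3 : (2 < n)%N.

Definition encode_state (s : state n J) : seq (word n) :=
  encode_seq (card_cell n3) ((inl s.1 : cell) :: [seq (inr r : cell) | r <- s.2]).

Definition decode_state (mem : seq (word n)) : state n J :=
  if decode_seq cell 7 (size mem %/ 7) mem is inl t :: s then
    (t, pmap (fun c : cell => if c is inr r then Some r else None) s)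
  else sampler_init n J.

Lemma encode_stateK : cancel encode_state decode_state.
Proof.
case=> t s; rewrite /decode_state /encode_state size_encode_seq mulKn //.
rewrite encode_seqK /=; congr (_, _); elim: s => //= r s IHs; by rewrite IHs.
Qed.

Lemma size_encode_state s : size (encode_state s) = (7 * (size s.2).+1)%N.
Proof. by rewrite /encode_state size_encode_seq /= size_map. Qed.

Definition alg_step mem it (v : R) (x : 'I_M.+1) : seq (word n) :=
  encode_state (sampler_step B gam (decode_state mem) it (olevel J a beta v) x).

Fact alg_meas mem it x mem' : measurable [set v | alg_step mem it v x = mem']%classic.
Proof.
exact: (measurable_olevel a beta (fun j => encode_state
  (sampler_step B gam (decode_state mem) it j x) = mem')).
Qed.

Definition alg : stream_alg R n :=
  StreamAlg (encode_state (sampler_init n J))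
    (fun mem => sampler_out R (decode_state mem)) alg_meas.

Definition edge_level (p : {set 'I_n} -> R) (it : 'I_n * 'I_n) : 'I_J.+1 :=
  olevel J a beta (p (edge it.1 it.2)).

Lemma alg_foldl p z s :
  foldl (fun mem ic => alg_step mem ic.1 (p (edge ic.1.1 ic.1.2)) ic.2)
    (encode_state s) z =
  encode_state (foldl (fun s ic =>
    sampler_step B gam s ic.1 (edge_level p ic.1) ic.2) s z).
Proof. by elim: z s => //= ic z IHz s; rewrite /alg_step encode_stateK IHz. Qed.

Lemma alg_result p st (coins : seq 'I_M.+1) : sa_result (A := alg) p st coins =
  sampler_out R (sampler_run B gam (edge_level p) (sampler_init n J) st coins).
Proof. by rewrite /sa_result last_scanl /= alg_foldl encode_stateK. Qed.

Lemma alg_space p st (coins : seq 'I_M.+1) : 0 <= B -> 0 <= gam ->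
  (size st <= n * n)%N ->
  (sa_space (A := alg) p st coins)%:R <= 7 * (1 + B + gam * (size st)%:R).
Proof.
move=> B0 gam0 szst; have gst : 0 <= gam * (size st)%:R by rewrite mulr_ge0.
rewrite /sa_space big_seq; apply: (big_ind (fun k : nat => k%:R <= _)).
- by apply: mulr_ge0; lra.
- by move=> k l; rewrite /maxn; case: ifP.
move=> mem /foldl_scanl[i ->] /=; rewrite take_zip alg_foldl size_encode_state.
have szt : (size (take i st) <= size st)%N by rewrite size_take_min geq_minr.
have [||le1 le2] := @sampler_run_size R n J M B gam (edge_level p)
  (sampler_init n J) (take i st) (take i coins) gam0.
- by rewrite add0n (leq_trans szt).
- by rewrite mulr0 addr0.
rewrite natrM ler_wpM2l // -nat1r -addrA lerD2l (le_trans le2) // lerD2l.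
by rewrite ler_wpM2l // ler_nat (leq_trans le1).
Qed.

End Algorithm.

(** * Oracle tails *)

Lemma measurable_ray_gt (R : realType) (c : R) : measurable [set v : R | c < v]%classic.
Proof.
rewrite (_ : mkset _ = `]c, +oo[%classic); first exact: measurable_itv.
by apply/seteqP; split=> v /=; rewrite in_itv /= andbT.
Qed.

Lemma measurable_ray_lt (R : realType) (c : R) : measurable [set v : R | v < c]%classic.
Proof.
rewrite (_ : mkset _ = `]-oo, c[%classic); first exact: measurable_itv.
by apply/seteqP; split=> v /=; rewrite in_itv.
Qed.

Lemma measurable_ray_le (R : realType) (c : R) : measurable [set v : R | v <= c]%classic.
Proof.
rewrite (_ : mkset _ = `]-oo, c]%classic); first exact: measurable_itv.
by apply/seteqP; split=> v /=; rewrite in_itv.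
Qed.

(** The terms double at each step and the last one included is at most 1. *)
Lemma sum_rate_le2 (R : realType) (J : nat) (y : R) : 0 <= y ->
  \sum_(k < J) (if y <= rate R k.+1 then y / rate R k.+1 else 0) <= 2.
Proof.
move=> y0.
have le1 m : \sum_(k < m) (if y <= rate R k.+1 then y / rate R k.+1 else 0) <=
    2 * (y / rate R m).
  elim: m => [|m IHm]; first by rewrite big_ord0 mulr_ge0 ?divr_ge0 // ltW ?rate_gt0.
  rewrite big_ord_recr /=.
  have -> : 2 * (y / rate R m.+1) = 2 * (y / rate R m) + y / rate R m.+1.
    by rewrite rateS; field; rewrite gt_eqF ?rate_gt0.
  rewrite lerD //; case: ifP => // _.
  by rewrite divr_ge0 // ltW ?rate_gt0.
elim: J => [|m IHm]; first by rewrite big_ord0.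
have := le1 m.+1; rewrite big_ord_recr /=; case: ifP => [le _|_ _]; last first.
  by rewrite addr0.
have := le1 m.+1; rewrite big_ord_recr /= le => h; apply: le_trans h _.
by rewrite ler_piMr // ler_pdivrMr ?mul1r ?rate_gt0.
Qed.

(** * The finite joint law of the levels *)

Section OracleLaw.
Variables (R : realType) (d : measure_display) (Omega : measurableType d).
Variables (P : probability Omega R) (n J : nat) (a beta : R).
Variable p : {set 'I_n} -> {RV P >-> R}.

(** The run sees the oracle only through the levels, which take finitely many joint values;
    expectations over the oracle become finite sums weighted by [level_law]. *)
Definition level_map : finType := {ffun {set 'I_n} -> 'I_J.+1}.

Definition levels (w : Omega) : level_map := [ffun e => olevel J a beta (p e w)].

Lemma measurable_levels (Phi : level_map -> Prop) :
  measurable [set w | Phi (levels w)]%classic.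
Proof.
pose f (e : {set 'I_n}) (w : Omega) := level J a beta (p e w).
pose Psi (s : seq nat) :=
  Phi [ffun e : {set 'I_n} => inord (nth 0%N s (enum_rank e)) : 'I_J.+1].
have -> : [set w | Phi (levels w)]%classic =
    [set w | Psi [seq f e w | e <- enum {set 'I_n}]]%classic.
  apply/seteqP; split=> w /=; rewrite /Psi; congr Phi; apply/ffunP => e;
    rewrite !ffunE (nth_map finset.set0) ?nth_enum_rank -?cardE ?ltn_ord //;
    by apply: val_inj; rewrite /= inordK // ltnS level_le.
refine (measurable_map (f := f) (enum {set 'I_n}) Psi _) => e k.
have mk := measurable_olevel (J := J) a beta (fun j => j = k :> nat).
exact: (measurable_funPTI (p e) mk).
Qed.

Definition level_law (f : level_map) : R := fine (P [set w | levels w = f]%classic).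

Lemma level_law_ge0 f : 0 <= level_law f.
Proof. by rewrite fine_ge0. Qed.

Lemma prob_levels (Phi : pred level_map) :
  P [set w | Phi (levels w)]%classic = (\sum_(f | Phi f) level_law f)%:E.
Proof.
have gen (s : seq level_map) : uniq s ->
    P [set w | levels w \in s]%classic = (\sum_(f <- s) level_law f)%:E.
  elim: s => [_|f s IHs /= /andP[fs us]].
    by rewrite big_nil (_ : mkset _ = set0) ?measure0 //; apply/seteqP; split.
  rewrite big_cons EFinD -IHs // /level_law fineK ?fin_num_measure //; last first.
    exact: (measurable_levels (fun g => g = f)).
  rewrite -measureU.
  - congr (P _); apply/seteqP; split=> w /=; rewrite inE.
      by case/orP => [/eqP|]; [left|right].
    by case=> [->|->]; rewrite ?eqxx ?orbT.
  - exact: (measurable_levels (fun g => g = f)).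
  - exact: (measurable_levels (fun g => g \in s)).
  - by apply/seteqP; split=> w //= -[-> fs']; rewrite fs' in fs.
rewrite -big_enum /= -gen ?enum_uniq //; congr (P _).
by apply/seteqP; split=> w /=; rewrite mem_enum.
Qed.

Lemma sum_level_law : \sum_f level_law f = 1.
Proof.
apply/EFin_inj; rewrite -(prob_levels xpredT) (_ : mkset _ = setT) ?probability_setT //.
by apply/seteqP; split.
Qed.

(** The marginal law at one edge. By linearity, means of sums over edges involve only these
    marginals, which the oracle tails control. *)
Definition edge_law (e : {set 'I_n}) (j : 'I_J.+1) : R :=
  \sum_(f : level_map | f e == j) level_law f.

Lemma edge_law_ge0 e j : 0 <= edge_law e j.
Proof. by apply: sumr_ge0 => f _; exact: level_law_ge0. Qed.

Lemma sum_edge_law e (h : 'I_J.+1 -> R) :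
  \sum_f level_law f * h (f e) = \sum_j h j * edge_law e j.
Proof.
rewrite (partition_big (fun f : level_map => f e) xpredT) //=.
apply: eq_bigr => j _; rewrite mulr_sumr; apply: eq_bigr => f /eqP ->.
by rewrite mulrC.
Qed.

Lemma edge_law_le e j (E : set R) t : measurable E ->
  (forall v, olevel J a beta v = j -> E v) ->
  (P [set w | E (p e w)]%classic <= t%:E)%E -> edge_law e j <= t.
Proof.
move=> mE sub Pt; rewrite -lee_fin -(prob_levels (fun f => f e == j)).
apply: le_trans Pt; apply: le_measure; rewrite ?inE.
- exact: (measurable_levels (fun f => f e == j)).
- exact: (measurable_funPTI (p e) mE).
by move=> w /=; rewrite ffunE => /eqP/sub.
Qed.

Variables (G : rel 'I_n) (sigma : seq 'I_n) (alpha K : R).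
Hypotheses (orc : value_oracle2 G sigma alpha beta K p).
Hypotheses (alpha0 : 0 <= alpha) (beta0 : 0 <= beta) (K_gt0 : 0 < K).

(** * Tails, mean excess and mean variance at one edge *)

Section OneEdge.
Variables x y : 'I_n.
Hypotheses (Gxy : G x y) (xy : arrives_before sigma x y).

Notation v := (p (edge x y)).
Notation r := ((Rcount G sigma x y)%:R : R).

(** With [K + 1] in place of [K] the bound exceeds 1 for [lam < 1], so the tail holds for every
    positive [lam]. *)
Lemma oracle_upper_weak (lam : R) : 0 < lam ->
  (P [set w | (lam * alpha * r + beta < v w)%R]%classic <= ((K + 1) / lam)%:E)%E.
Proof.
move=> lam0; have [lam1|lam1] := leP 1 lam.
  have [le1 _] := orc Gxy xy lam1; apply: le_trans le1 _.
  by rewrite lee_fin ler_pM2r ?invr_gt0 // lerDl.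
apply: (@le_trans _ _ 1%E).
  apply: probability_le1.
  exact: (measurable_funPTI v (measurable_ray_gt (lam * alpha * r + beta))).
by rewrite lee_fin ler_pdivlMr // mul1r ltW // (lt_trans lam1) // ltrDr.
Qed.

Lemma oracle_lower_weak (lam : R) : 0 < lam ->
  (P [set w | (v w < r / lam - beta)%R]%classic <= ((K + 1) / lam)%:E)%E.
Proof.
move=> lam0; have [lam1|lam1] := leP 1 lam.
  have [_ le1] := orc Gxy xy lam1; apply: le_trans le1 _.
  by rewrite lee_fin ler_pM2r ?invr_gt0 // lerDl.
apply: (@le_trans _ _ 1%E).
  apply: probability_le1.
  exact: (measurable_funPTI v (measurable_ray_lt (r / lam - beta))).
by rewrite lee_fin ler_pdivlMr // mul1r ltW // (lt_trans lam1) // ltrDr.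
Qed.

Lemma oracle_upper (u : R) : 0 < u ->
  (P [set w | (beta + u < v w)%R]%classic <= ((K + 1) * (alpha * r) / u)%:E)%E.
Proof.
move=> u0; have [ar0|ar0] := ltP 0 (alpha * r).
  have lam0 : 0 < u / (alpha * r) by rewrite divr_gt0.
  have := oracle_upper_weak lam0.
  have -> : u / (alpha * r) * alpha * r + beta = beta + u.
    by rewrite addrC -mulrA divfK // gt_eqF.
  by rewrite invf_div (mulrA (K + 1) (alpha * r)).
have {ar0} ar0 : alpha * r = 0 by apply/le_anti; rewrite ar0 mulr_ge0.
(* When [alpha * r = 0] the threshold does not depend on [lam], so letting [lam] grow shows that the
   probability is 0. *)
rewrite ar0 mulr0 mul0r; apply/lee_addgt0Pr => eps eps0; rewrite add0e.
have lam0 : 0 < (K + 1) / eps by rewrite divr_gt0 // addr_gt0.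
have := oracle_upper_weak lam0; rewrite invf_div mulrCA divff ?mulr1; last first.
  by rewrite gt_eqF // addr_gt0.
apply: le_trans; apply: le_measure; rewrite ?inE.
- exact: (measurable_funPTI v (measurable_ray_gt (beta + u))).
- exact: (measurable_funPTI v (measurable_ray_gt ((K + 1) / eps * alpha * r + beta))).
by move=> w /=; rewrite -mulrA ar0 mulr0 add0r; lra.
Qed.

(** Take [lam = r / (2 * beta + 2 * h)], for which [r / lam - beta = beta + 2 * h]; the doubled [h]
    places the closed event inside the open one. *)
Lemma oracle_lower (h : R) : 0 < h -> 0 < r ->
  (P [set w | (v w <= beta + h)%R]%classic <= ((K + 1) * (2 * beta + 2 * h) / r)%:E)%E.
Proof.
move=> h0 r0; have c0 : 0 < 2 * beta + 2 * h by move: beta0; lra.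
have lam0 : 0 < r / (2 * beta + 2 * h) by rewrite divr_gt0.
have := oracle_lower_weak lam0.
rewrite !invf_div (mulrA r) (mulrA (K + 1)).
have -> : r * (2 * beta + 2 * h) / r - beta = beta + 2 * h.
  by rewrite mulrAC divff ?mul1r ?gt_eqF //; ring.
apply: le_trans; apply: le_measure; rewrite ?inE.
- exact: (measurable_funPTI v (measurable_ray_le (beta + h))).
- exact: (measurable_funPTI v (measurable_ray_lt (beta + 2 * h))).
by move=> w /=; lra.
Qed.

(** If the lower threshold exceeded the upper one, every value would lie in one of the two tails,
    forcing [1 <= 2 * K / lam]. *)
Lemma oracle_consistent (lam : R) : 1 <= lam -> 2 * K < lam ->
  r / lam - beta <= lam * alpha * r + beta.
Proof.
move=> lam1 Klam; rewrite leNgt; apply/negP => gap.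
have K0 := K_gt0; have [up lo] := orc Gxy xy lam1; have lam0 : 0 < lam by lra.
set A := [set w | _ < v w]%classic in up; set C := [set w | v w < _]%classic in lo.
have mA : measurable A.
  exact: (measurable_funPTI v (measurable_ray_gt (lam * alpha * r + beta))).
have mC : measurable C.
  exact: (measurable_funPTI v (measurable_ray_lt (r / lam - beta))).
have : (1 <= (K / lam + K / lam)%:E :> \bar R)%E.
  rewrite -(@probability_setT _ _ _ P) EFinD.
  apply: le_trans (leeD up lo); apply: le_trans (measureU2 _ mA mC).
  apply: le_measure; rewrite ?inE //; first exact: measurableU.
  move=> w _ /=; rewrite /A /C /=.
  by have [|le] := ltP (v w) (r / lam - beta); [right|left; lra].
by rewrite lee_fin -mulrDl ler_pdivlMr //; lra.
Qed.

Hypotheses (a0 : 0 < a) (J0 : (0 < J)%N).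

(** A level with a larger rate cannot result from the test on [a * beta] (the factor 2 is the dyadic
    rounding) nor from reaching level [J]; only a large oracle value explains it. *)
Definition base_rate : R := 2 * (a * beta) + rate R J.

Definition excess (j : nat) : R := if rate R j <= base_rate then 0 else rate R j.

(** Level 0 is sampled with certainty and adds no variance, hence the value 0. *)
Definition inv_rate (j : nat) : R := if j == 0%N then 0 else (rate R j)^-1.

Let aJ0 : 0 < a * J%:R. Proof. by rewrite mulr_gt0 ?ltr0n. Qed.

(** A level [j < J] above the base rate needs a value above [beta + rate j.+1 / (a * J)]. Its
    probability is inversely proportional to the rate, so each of the [J] levels contributes at most
    the same amount. *)
Lemma mean_excess : \sum_f level_law f * excess (f (edge x y)) <=
  2 * (K + 1) * alpha * a * J%:R ^+ 2 * r.
Proof.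
rewrite (sum_edge_law _ (fun j => excess j)) big_ord_recr /=.
have -> : excess J = 0 by rewrite /excess ifT // lerDr mulr_ge0 // mulr_ge0 // ltW.
rewrite mul0r addr0.
have -> : 2 * (K + 1) * alpha * a * J%:R ^+ 2 * r =
    \sum_(j < J) (2 * (K + 1) * alpha * a * J%:R * r).
  by rewrite sumr_const card_ord -mulr_natl; ring.
apply: ler_sum => j _; rewrite /excess /=; case: ifP => [_|/negbT].
  by rewrite mul0r !mulr_ge0 // ?addr_ge0 // ltW.
rewrite -ltNge => above; set j' : 'I_J.+1 := widen_ord _ j.
have rj0 := rate_gt0 R j; have rj1 := rate_gt0 R j.+1.
have u0 : 0 < rate R j.+1 / (a * J%:R) by rewrite divr_gt0.
have := edge_law_le (j := j')
  (measurable_ray_gt (beta + rate R j.+1 / (a * J%:R))) _ (oracle_upper u0).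
rewrite -(ler_pM2l rj0) => le; apply: le_trans (le _) _.
  (* Stopping at [j] means that [below j] fails; its test on [a * beta] succeeds above the base
     rate, so the test on the value is the one that fails. *)
  move=> v jv /=; rewrite ltNge; apply/negP => vle.
  have lv : level J a beta v = j by rewrite -[LHS]/(val (olevel J a beta v)) jv.
  have := @level_above R J a beta v; rewrite lv ltn_ord => /(_ isT).
  rewrite /below vle andbT -ltNge; move: above; rewrite /base_rate rateS.
  by have := rate_gt0 R J; lra.
rewrite rateS le_eqVlt; apply/orP; left; apply/eqP; field.
by rewrite ?gt_eqF ?ltr0n.
Qed.

(** Level [k.+1] requires a value at most [beta + h] with [h = rate k.+1 / (a * J)], and the lower
    tail applies. After division by the rate, the [beta] part is a geometric sum, at most 4 after
    doubling, and the [h] part gives [2 / J] per level: together the constant 6. *)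
Lemma mean_inv_rate :
  \sum_f level_law f * (r ^+ 2 * inv_rate (f (edge x y))) <= r * (6 * (K + 1) / a).
Proof.
have [r0|r0] := ltP 0 r; last first.
  have -> : r = 0 by apply/le_anti; rewrite r0 ler0n.
  rewrite mul0r big1 // => f _; by rewrite expr0n mul0r mulr0.
rewrite (sum_edge_law _ (fun j => r ^+ 2 * inv_rate j)) big_ord_recl /= {1}/inv_rate /=.
rewrite mulr0 mul0r add0r.
apply: (@le_trans _ _ (\sum_(k < J) r * ((K + 1) / a) * (2 *
    (if a * beta <= rate R k.+1 then a * beta / rate R k.+1 else 0) + 2 / J%:R))).
  apply: ler_sum => k _; rewrite /inv_rate /= /bump /= add1n.
  set j : 'I_J.+1 := lift ord0 k.
  have h0 := rate_gt0 R k.+1; set h := rate R k.+1 in h0 *.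
  have jk v : olevel J a beta v = j -> below J a beta k v.
    by move=> jv; apply: level_below; rewrite -[LHS]/(val (olevel J a beta v)) jv.
  have Ka : 0 <= r * ((K + 1) / a) by rewrite mulr_ge0 ?divr_ge0 ?ltW // addr_gt0.
  have J0' : 0 < J%:R :> R by rewrite ltr0n.
  (* When the rate is below [a * beta] the level is unreachable and its probability is 0. *)
  case: ifPn => aba; last first.
    have le0 : edge_law (edge x y) j <= 0.
      apply: (edge_law_le (E := set0)) => //; first by move=> v /jk/andP[]; rewrite (negPf aba).
      by rewrite (_ : mkset _ = set0) ?measure0 //; apply/seteqP; split.
    have -> : edge_law (edge x y) j = 0 by apply/le_anti; rewrite le0 edge_law_ge0.
    by rewrite !mulr0 add0r mulr_ge0 // divr_ge0.
  have haJ : 0 < h / (a * J%:R) by rewrite divr_gt0.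
  have := edge_law_le (j := j)
    (measurable_ray_le (beta + h / (a * J%:R))) _ (oracle_lower haJ r0).
  have c0 : 0 < r ^+ 2 / h by rewrite divr_gt0 // exprn_gt0.
  move=> le; apply: le_trans (_ : _ <= r ^+ 2 / h *
      ((K + 1) * (2 * beta + 2 * (h / (a * J%:R))) / r)) _.
    by rewrite (ler_pM2l c0); apply: le => v /jk/andP[].
  rewrite le_eqVlt; apply/orP; left; apply/eqP; field.
  by rewrite ?gt_eqF.
rewrite -mulr_sumr big_split /= -mulr_sumr sumr_const card_ord.
have ab0 : 0 <= a * beta by rewrite mulr_ge0 // ltW.
have := sum_rate_le2 J ab0; set S := \sum_(_ < _) _ => S2.
have -> : 2 / J%:R *+ J = 2 :> R by rewrite -mulr_natr divfK // pnatr_eq0 -lt0n.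
have -> : r * (6 * (K + 1) / a) = r * ((K + 1) / a) * 6 by ring.
rewrite ler_wpM2l //; last by lra.
by rewrite mulr_ge0 ?divr_ge0 ?ltW // addr_gt0.
Qed.

End OneEdge.
End OracleLaw.

(** * Probability of success *)

Section Correctness.
Variables (R : realType) (n : nat) (G : rel 'I_n) (sigma : seq 'I_n).
Variables (adj : 'I_n -> seq 'I_n).
Variables (d : measure_display) (Omega : measurableType d) (P : probability Omega R).
Variable p : {set 'I_n} -> {RV P >-> R}.
Variables (a alpha beta K delta Q : R).
Hypotheses (n3 : (2 < n)%N) (sG : simple_graph G) (oG : adj_order G sigma adj).
Hypotheses (orc : value_oracle2 G sigma alpha beta K p).
Hypotheses (alpha0 : 0 <= alpha) (beta0 : 0 <= beta) (K_gt0 : 0 < K) (a0 : 0 < a).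

Notation J := (depth n).
Notation M := (coin_max n).
Notation st := (adj_stream sigma adj).
Notation T := (#|triangles G|%:R : R).
Notation law := (level_law (J := J) a beta p).
Notation rho := (base_rate J a beta).
Notation exc := (excess J a beta).
Notation edge_gain := (fun x y => (gain G sigma x y)%:R : R).
Notation B := (8 + 2 * Q).
Notation gam := (2 * rho).

Lemma depth_gt0 : (0 < J)%N.
Proof. by rewrite muln_gt0 up_log_gt0 (ltn_trans _ n3). Qed.

Lemma edgeC (x y : 'I_n) : edge x y = edge y x.
Proof. exact: finset.setUC. Qed.

Implicit Type f : level_map n J.

Definition item_level f (it : 'I_n * 'I_n) : 'I_J.+1 := f (edge it.1 it.2).

Definition total_excess f : R := \sum_(it <- st) exc (item_level f it).

Lemma excess_ge0 j : 0 <= exc j.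
Proof. by rewrite /excess; case: ifP => // _; rewrite ltW ?rate_gt0. Qed.

Lemma rate_le_excess j : rate R j <= rho + exc j.
Proof.
rewrite /excess; case: ifP => [|_]; first by rewrite addr0.
by rewrite lerDr addr_ge0 ?mulr_ge0 // ltW ?rate_gt0.
Qed.

Lemma sum_edge_gain : \sum_x \sum_(y | G x y) edge_gain x y = T.
Proof.
rewrite -(sum_gain sG oG) natr_sum; apply: eq_bigr => x _.
by rewrite natr_sum.
Qed.

Lemma level_gainsE f : level_gains R (item_level f) st =
  [seq (val (item_level f it), edge_gain it.1 it.2) | it <- st].
Proof. by rewrite /level_gains (gains_stream sG oG) -map_comp zip_map. Qed.

Lemma mean_total_excess : \sum_f law f * total_excess f <=
  4 * (K + 1) * alpha * a * J%:R ^+ 2 * T.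
Proof.
pose F x y := \sum_f law f * exc (f (edge x y)).
have -> : \sum_f law f * total_excess f = \sum_(it <- st) F it.1 it.2.
  rewrite exchange_big /=; apply: eq_bigr => f _.
  by rewrite /total_excess mulr_sumr.
rewrite (sum_stream oG) (sum_sym sG oG); last by move=> x y; rewrite /F edgeC.
have -> : 4 * (K + 1) * alpha * a * J%:R ^+ 2 * T =
    (2 * (K + 1) * alpha * a * J%:R ^+ 2 * T) *+ 2 by ring.
rewrite lerMn2r /= -sum_edge_gain mulr_sumr; apply: ler_sum => x _.
rewrite mulr_sumr; apply: ler_sum => y Gxy; rewrite /gain.
case: ifP => xy; last by rewrite mulr0.
exact: (mean_excess orc alpha0 beta0 K_gt0 Gxy xy a0 depth_gt0).
Qed.

Definition variance f : R :=
  \sum_(it <- st) edge_gain it.1 it.2 ^+ 2 * inv_rate R (item_level f it).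

Lemma mean_variance : \sum_f law f * variance f <= 6 * (K + 1) / a * T.
Proof.
pose F x y := \sum_f law f * (edge_gain x y ^+ 2 * inv_rate R (f (edge x y))).
have -> : \sum_f law f * variance f = \sum_(it <- st) F it.1 it.2.
  rewrite exchange_big /=; apply: eq_bigr => f _.
  by rewrite /variance mulr_sumr.
rewrite (sum_stream oG) -sum_edge_gain mulr_sumr; apply: ler_sum => x _.
rewrite mulr_sumr; apply: ler_sum => y Gxy; rewrite /F /gain.
case: ifP => xy; last first.
  by rewrite mulr0 big1 // => f _; rewrite expr0n mul0r mulr0.
rewrite [leRHS]mulrC.
exact: (mean_inv_rate orc beta0 K_gt0 Gxy xy a0 depth_gt0).
Qed.

Definition good f (cs : seq 'I_M.+1) : bool :=
  let X := sampler_out R (sampler_run B gam (item_level f) (sampler_init n J) st cs) in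
  ((1 - delta) * T <= X) && (X <= (1 + delta) * T).

Hypotheses (delta0 : 0 < delta) (T0 : 0 < T).
Hypotheses (aT : 60 * (K + 1) <= a * delta ^+ 2 * T).
Hypothesis QT : 1 + 40 * (K + 1) * alpha * a * J%:R ^+ 2 * T <= Q.

Lemma Q_gt0 : 0 < Q.
Proof.
apply: lt_le_trans QT; rewrite ltr_pwDl // !mulr_ge0 //; try exact: ltW.
by rewrite addr_ge0 // ltW.
Qed.

(** For fixed levels the losses are Chebyshev's term, a Markov term for the total excess beyond [Q],
    and an overflow with slack 8, of probability at most e^(-4). *)
Lemma good_prob f : 1 - variance f / (delta * T) ^+ 2 - total_excess f / Q - 10^-1 <=
  avg (size st) (fun cs => (good f cs)%:R).
Proof.
have Q0 := Q_gt0.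
have lJ : all (fun q : nat * R => q.1 <= J)%N (level_gains R (item_level f) st).
  by rewrite level_gainsE all_map; apply/allP => it _ /=; rewrite -ltnS ltn_ord.
have jJ : all (leq^~ J) [seq val (item_level f it) | it <- st].
  by rewrite all_map; apply/allP => it _ /=; rewrite -ltnS ltn_ord.
have dT : 0 < (delta * T) ^+ 2 by rewrite exprn_gt0 // mulr_gt0.
have D0 : 0 <= total_excess f by apply: sumr_ge0 => it _; exact: excess_ge0.
pose est cs := estimate J (level_gains R (item_level f) st) (cs : seq 'I_M.+1).
pose ovf (cs : seq 'I_M.+1) := overflow J [seq val (item_level f it) | it <- st] cs (8 : R).
have pointwise cs : size cs = size st ->
    1 - total_excess f / Q + (- ((delta * T) ^+ 2)^-1 * (est cs - T) ^+ 2 +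
      -1 * (ovf cs)%:R) <= (good f cs)%:R.
  move=> szc; have DQ : 0 <= total_excess f / Q by rewrite divr_ge0 // ltW.
  have E0 : 0 <= ((delta * T) ^+ 2)^-1 * (est cs - T) ^+ 2.
    by rewrite mulr_ge0 ?sqr_ge0 // invr_ge0 ltW.
  (* If the excess is larger than [Q], the Markov term alone makes the left side nonpositive. *)
  have [big|small] := ltP Q (total_excess f).
    have : 1 <= total_excess f / Q by rewrite ler_pdivlMr // mul1r ltW.
    by case: (good _ _); case: (ovf _) => /=; lra.
  case ov: (ovf cs); first by case: (good _ _) => /=; lra.
  suff : good f cs || (1 <= ((delta * T) ^+ 2)^-1 * (est cs - T) ^+ 2).
    by case: (good _ _) => /=; lra.
  rewrite [_^-1 * _]mulrC ler_pdivlMr // mul1r /good.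
  rewrite (@sampler_run_out R n J M B gam (item_level f) exc rho
    excess_ge0 rate_le_excess _ _ _ 8) //; last first.
  - by rewrite /= mulr0 addr0; rewrite -/(total_excess f); lra.
  - by rewrite -/(ovf cs) ov.
  - by rewrite add0n (size_stream_sqr oG).
  rewrite big_nil add0r -/(est cs).
  have dT0 : 0 <= delta * T by rewrite mulr_ge0 // ltW.
  have sq (z : R) : delta * T <= z -> (delta * T) ^+ 2 <= z ^+ 2.
    by move=> le; rewrite lerXn2r ?nnegrE // (le_trans _ le).
  have [lo|lo] /= := leP ((1 - delta) * T) (est cs); last first.
    by rewrite -[leRHS]sqrrN sq //; lra.
  by have [hi|hi] //= := leP (est cs) ((1 + delta) * T); rewrite sq //; lra.
have := avg_le (L := size st) pointwise; apply: le_trans.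
rewrite !avgD !avg_cst !avgZ.
have e4 : avg (size st) (fun cs => (ovf cs)%:R) <= 10^-1 :> R.
  have := @overflow_prob R M J _ 8 (coins_pow2 n) jJ.
  rewrite size_map => /le_trans; apply.
  have -> : - 8 / 2 = - 4 :> R by field.
  rewrite expRN lef_pV2 ?posrE ?expR_gt0 //.
  by apply: le_trans (expR_ge1Dxn 3 _) => //; rewrite /factorial /=; lra.
have szl : size (level_gains R (item_level f) st) = size st.
  by rewrite level_gainsE size_map.
have sumT : \sum_(q <- level_gains R (item_level f) st) q.2 = T.
  by rewrite level_gainsE big_map /= (sum_stream oG edge_gain) sum_edge_gain.
have := estimate_var (coins_pow2 n) lJ; rewrite szl sumT => ->.
have le_var : \sum_(q <- level_gains R (item_level f) st)
    q.2 ^+ 2 * ((rate R q.1)^-1 - 1) <= variance f.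
  rewrite level_gainsE big_map; apply: ler_sum => it _ /=.
  rewrite ler_wpM2l ?sqr_ge0 // /inv_rate; case: ifP => [/eqP ->|_].
    by rewrite /rate expr0 invr1 subrr.
  by rewrite lerBlDr lerDl.
have : variance f / (delta * T) ^+ 2 >= ((delta * T) ^+ 2)^-1 * 
    \sum_(q <- level_gains R (item_level f) st) q.2 ^+ 2 * ((rate R q.1)^-1 - 1).
  by rewrite mulrC ler_pM2r // invr_gt0.
move: e4; rewrite mulNr mulN1r.
set o := avg _ _; set u := _^-1 * _; set v := variance f / _; set D := total_excess f / Q.
by lra.
Qed.

(** The constants 60 and 40 in the hypotheses [aT] and [QT] are ten times those of [mean_variance]
    and [mean_total_excess], so each of the three losses averages to at most 1/10. *)
Lemma mean_good_prob :
  7 / 10 <= \sum_f law f * avg (size st) (fun cs => (good f cs)%:R).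
Proof.
have Q0 := Q_gt0.
have dT : 0 < (delta * T) ^+ 2 by rewrite exprn_gt0 // mulr_gt0.
apply: (@le_trans _ _ (\sum_f law f *
    (1 - variance f / (delta * T) ^+ 2 - total_excess f / Q - 10^-1))); last first.
  by apply: ler_sum => f _; rewrite ler_wpM2l ?level_law_ge0 // good_prob.
have -> : \sum_f law f *
    (1 - variance f / (delta * T) ^+ 2 - total_excess f / Q - 10^-1) =
    (1 - 10^-1) * \sum_f law f - (\sum_f law f * variance f) / (delta * T) ^+ 2
    - (\sum_f law f * total_excess f) / Q.
  rewrite mulr_sumr !mulr_suml -!sumrB; apply: eq_bigr => f _; ring.
rewrite sum_level_law.
have V10 : (\sum_f law f * variance f) / (delta * T) ^+ 2 <= 10^-1.
  rewrite ler_pdivrMr //; apply: le_trans mean_variance _.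
  rewrite -(ler_pM2l a0).
  have -> : a * (6 * (K + 1) / a * T) = 10^-1 * (60 * (K + 1)) * T.
    by field; rewrite gt_eqF.
  have -> : a * (10^-1 * (delta * T) ^+ 2) = 10^-1 * (a * delta ^+ 2 * T) * T by ring.
  by rewrite ler_pM2r // ler_pM2l // invr_gt0.
have D10 : (\sum_f law f * total_excess f) / Q <= 10^-1.
  rewrite ler_pdivrMr //; apply: le_trans mean_total_excess _.
  by move: QT; lra.
by lra.
Qed.

(** For fixed coins, success depends on the oracle only through the levels, so its probability is a
    finite sum and the averages over coins and levels can be exchanged. *)
Lemma alg_success :
  ((7%:R / 10%:R)%:E <=
   sa_prob (alg a beta B gam n3) p st (approximates delta T))%E.
Proof.
rewrite /sa_prob.
have -> : (\sum_(cs : (size st).-tuple 'I_(sa_coin (alg a beta B gam n3)).+1)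
    P [set w | approximates delta T (sa_result (A := alg a beta B gam n3)
      (fun e => p e w) st cs)]%classic)%E =
    (\sum_(cs : (size st).-tuple 'I_M.+1) \sum_f law f * (good f cs)%:R)%:E.
  rewrite -sumEFin; apply: eq_bigr => cs _.
  have -> : [set w | approximates delta T (sa_result (A := alg a beta B gam n3)
      (fun e => p e w) st cs)]%classic =
      [set w | good (levels J a beta p w) cs]%classic.
    congr mkset; apply/funext => w.
    rewrite (alg_result a beta B gam n3 (fun e => p e w) st cs).
    suff -> : edge_level a beta (fun e => p e w) = item_level (levels J a beta p w) by [].
    by apply/funext => it; rewrite /item_level ffunE.
  rewrite (prob_levels a beta p (fun f => good f cs)) big_mkcond; congr EFin.
  by apply: eq_bigr => f _; case: good; rewrite ?mulr1 ?mulr0.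
rewrite -EFinM lee_fin; apply: le_trans mean_good_prob _.
rewrite exchange_big mulr_sumr /=; apply: ler_sum => f _.
by rewrite -mulr_sumr avg_sum_tuple mulrCA.
Qed.

End Correctness.

(** * Space *)

(** [oracle_consistent] bounds each R_e by [lam ^+ 2 * alpha * R_e + 2 * lam * beta]; summing over
    the edges gives the claim. It is what lets additive constants be absorbed in the space bound. *)
Lemma oracle_space_lower (R : realType) (n : nat) (G : rel 'I_n) (sigma : seq 'I_n)
    (adj : 'I_n -> seq 'I_n) (d : measure_display) (Omega : measurableType d)
    (P : probability Omega R) (p : {set 'I_n} -> {RV P >-> R})
    (alpha beta K lam : R) :
  simple_graph G -> adj_order G sigma adj ->
  value_oracle2 G sigma alpha beta K p -> 0 <= beta -> 0 < K ->
  1 <= lam -> 2 * K < lam ->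
  #|triangles G|%:R <=
    lam ^+ 2 * alpha * #|triangles G|%:R + 2 * lam * beta * #|edges G|%:R.
Proof.
move=> sG oG orc beta0 K0 lam1 Klam; have lam0 : 0 < lam by lra.
pose t := 2 * lam * beta; have t0 : 0 <= t by rewrite !mulr_ge0 // ltW.
have sumt : \sum_x \sum_(y | G x y) (if arrives_before sigma x y then t else 0) <=
    t * #|edges G|%:R.
  have : (\sum_x \sum_(y | G x y) (if arrives_before sigma x y then t else 0)) *+ 2 =
      t * (size (adj_stream sigma adj))%:R.
    rewrite -(sum_sym sG oG (F := fun _ _ => t)) // -(sum_stream oG).
    by rewrite big_const_seq count_predT iter_addr_0 mulr_natr.
  have : t * (size (adj_stream sigma adj))%:R <= t * (2 * #|edges G|%:R).
    by rewrite ler_wpM2l // -natrM ler_nat (size_stream_edges sG oG).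
  by lra.
apply: le_trans (lerD (lexx _) sumt).
rewrite -(sum_edge_gain R sG oG) mulr_sumr -big_split /=; apply: ler_sum => x _.
rewrite mulr_sumr -big_split /=; apply: ler_sum => y Gxy; rewrite /gain.
case: ifP => xy; last by rewrite mulr0 addr0.
have := oracle_consistent orc K0 Gxy xy lam1 Klam; rewrite lerBlDr ler_pdivrMr // /t.
by lra.
Qed.

(** * Logarithmic estimates for at least three vertices *)

Section Logarithms.
Variable R : realType.

Lemma ln3_gt1 : 1 < ln 3 :> R.
Proof.
(* Raising to the sixth power gives e^(-1) >= (5/6)^6 > 1/3. *)
have e6 : 5 / 6 <= expR (- 6^-1) :> R.
  by apply: le_trans (expR_ge1Dx _); lra.
have : (5 / 6) ^+ 6 <= expR (- 6^-1) ^+ 6 :> R by rewrite lerXn2r ?nnegrE ?expR_ge0 //; lra.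
rewrite -expRM_natl (_ : 6 * - 6^-1 = - 1); last by field.
rewrite expRN -[leRHS]mul1r ler_pdivlMr ?expR_gt0 // => e3.
rewrite -ltr_expR lnK ?posrE //; apply: contraTT e3; rewrite -!leNgt -ltNge => e3.
by apply: lt_le_trans (_ : (5 / 6) ^+ 6 * 3 <= _); [lra | rewrite ler_pM2l //; lra].
Qed.

Lemma ln_nat_ge3 n : (2 < n)%N -> ln 3 <= ln n%:R :> R.
Proof. by move=> n3; rewrite ler_ln ?posrE ?ltr0n ?(ltn_trans _ n3) // ler_nat. Qed.

Lemma lnln_nat_ge3 n : (2 < n)%N -> ln (ln 3) <= ln (ln n%:R) :> R.
Proof.
move=> n3; have l3 := ln3_gt1; have ln3 := ln_nat_ge3 n3.
by rewrite ler_ln ?posrE //; lra.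
Qed.

Lemma depth_le_ln n : (2 < n)%N ->
  (depth n)%:R <= 2 * ((ln 2)^-1 + 1) * ln n%:R :> R.
Proof.
move=> n3; have l3 := ln3_gt1; have ln3 := ln_nat_ge3 n3.
have ln2 : 0 < ln 2 :> R by rewrite ln_gt0 // ltr1n.
have n0 : 0 < n%:R :> R by rewrite ltr0n (ltn_trans _ n3).
have := up_log_gtn (isT : 1 < 2)%N (ltnW n3).
have : (0 < up_log 2 n)%N by rewrite up_log_gt0 (ltn_trans _ n3).
rewrite /depth; case: (up_log 2 n) => // w _ /= lt.
have wln : w%:R * ln 2 <= ln n%:R :> R.
  rewrite mulr_natl -lnXn // ler_ln ?posrE ?exprn_gt0 //.
  by rewrite -natrX ler_nat ltnW.
have wl : w%:R <= (ln 2)^-1 * ln n%:R :> R by rewrite mulrC ler_pdivlMr.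
by rewrite natrM -(natr1 w) -mulrA ler_pM2l // mulrDl mul1r lerD //; lra.
Qed.

End Logarithms.

(** * The algorithm that outputs a fixed number *)

Section ConstantAlgorithm.
Variables (R : realType) (n : nat) (t : R).

Fact const_alg_meas (mem : seq (word n)) (it : 'I_n * 'I_n) (x : 'I_1)
    (mem' : seq (word n)) :
  measurable [set v : R | (fun _ _ _ _ => [::]) mem it v x = mem']%classic.
Proof.
have [e|e] := pselect ([::] = mem').
  by rewrite (_ : mkset _ = setT) //; apply/seteqP; split.
by rewrite (_ : mkset _ = set0) //; apply/seteqP; split.
Qed.

Definition const_alg : stream_alg R n :=
  StreamAlg [::] (fun _ => t) const_alg_meas.

Lemma const_alg_space q st coins : sa_space (A := const_alg) q st coins = 0%N.
Proof.
rewrite /sa_space big1_seq // => mem /andP[_ /foldl_scanl[i ->]] /=.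
by elim: (take i _) => //= ? ? ->.
Qed.

Lemma const_alg_prob (d : measure_display) (Omega : measurableType d)
    (P : probability Omega R) (q : {set 'I_n} -> {RV P >-> R}) st (ok : R -> Prop) :
  ok t -> sa_prob const_alg q st ok = 1%E.
Proof.
move=> okt; rewrite /sa_prob (eq_bigr (fun=> 1%E)) => [|cs _]; last first.
  rewrite (_ : mkset _ = setT) ?probability_setT //; apply/seteqP; split=> w //= _.
rewrite (_ : \sum_(_ | _) 1 = 1)%E ?mule1 ?expr1n ?invr1 //.
by rewrite sumr_const card_tuple card_ord exp1n.
Qed.

End ConstantAlgorithm.

Lemma log_factor (R : realType) (n : nat) : (2 < n)%N ->
  let l3 := ln (ln 3) : R in
  let L := ln n%:R ^+ 3 * ln (ln n%:R) : R in
  [/\ 0 < l3, 1 <= L / l3 &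
      (depth n)%:R ^+ 2 <= (2 * ((ln 2)^-1 + 1)) ^+ 2 * (L / l3)].
Proof.
move=> n3 l3 L; have ln3 := ln3_gt1 R; have lnn := ln_nat_ge3 R n3.
have l30 : 0 < l3 by rewrite ln_gt0.
have lnn1 : 1 <= ln n%:R :> R by apply: le_trans lnn; exact: ltW.
have ll : 1 <= ln (ln n%:R) / l3 by rewrite ler_pdivlMr // mul1r lnln_nat_ge3.
have Lsqr : ln n%:R ^+ 2 <= L / l3.
  rewrite /L -mulrA; apply: le_trans (_ : ln n%:R ^+ 3 <= _).
    by rewrite ler_weXn2l.
  by rewrite ler_peMr // exprn_ge0 // (le_trans _ lnn1).
split=> //; first by apply: le_trans Lsqr; rewrite exprn_ege1.
have ln2 : 0 < ln 2 :> R by rewrite ln_gt0 // ltr1n.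
have g0 : 0 <= 2 * ((ln 2)^-1 + 1) :> R by rewrite mulr_ge0 // addr_ge0 ?invr_ge0 // ltW.
apply: le_trans (_ : (2 * ((ln 2)^-1 + 1) * ln n%:R) ^+ 2 <= _).
  by rewrite lerXn2r ?nnegrE ?depth_le_ln // mulr_ge0 // (le_trans _ lnn1).
by rewrite exprMn ler_wpM2l // exprn_ge0.
Qed.

(** * Choice of parameters and the final bounds *)

Theorem theoremB1 (R : realType) (c K0 : R) (hc : 1 <= c) (hK0 : 0 < K0) :
  exists C : R,
  forall (n : nat) (eps alpha beta K Tapx : R),
    0 < eps < 1 -> 0 <= alpha -> 0 <= beta -> K0 <= K ->
  exists A : stream_alg R n,
  forall (G : rel 'I_n) (sigma : seq 'I_n) (adj : 'I_n -> seq 'I_n),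
    simple_graph G -> adj_order G sigma adj ->
    (0 < #|triangles G|)%N ->
    #|triangles G|%:R / c <= Tapx <= c * #|triangles G|%:R ->
  forall (d : measure_display) (Omega : measurableType d)
    (P : probability Omega R) (p : {set 'I_n} -> {RV P >-> R}),
    value_oracle2 G sigma alpha beta K p ->
    (forall (w : Omega)
       (coins : (size (adj_stream sigma adj)).-tuple 'I_(sa_coin A).+1),
       (sa_space (fun e => p e w) (adj_stream sigma adj) coins)%:R <=
         C * space_bound n #|edges G| #|triangles G| eps alpha beta K) /\
    ((7%:R / 10%:R)%:E <=
       sa_prob A p (adj_stream sigma adj)
         (approximates (Num.sqrt K * eps) #|triangles G|%:R))%E.
Proof.
(* [q] turns [K + 1] into at most [q * K]. [C1] pays for additive constants, [C2] for [Q], and [C3]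
   for the base rate summed over the edges. *)
pose q := 1 + K0^-1.
pose l3 : R := ln (ln 3).
pose g : R := 2 * ((ln 2)^-1 + 1).
pose C1 := 9 * q ^+ 2 * c ^+ 2 / l3 + 6 * q.
pose C2 := 60 * q ^+ 2 * c ^+ 2 * g ^+ 2 / l3.
pose C3 := 60 * q * c ^+ 2 / K0.
exists (7 * (13 * C1 + 80 * C2 + 8 * C3)) => n eps alpha beta K Tapx.
move=> /andP[eps0 eps1] alpha0 beta0 K0K.
have K_gt0 : 0 < K by exact: lt_le_trans K0K.
have c0 : 0 < c by exact: lt_le_trans hc.
have q0 : 0 < q by rewrite addr_gt0 // invr_gt0.
have l30 : 0 < l3 by rewrite ln_gt0 // ln3_gt1.
have ln2 : 0 <= (ln 2)^-1 + 1 :> R.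
  by rewrite addr_ge0 // invr_ge0 ltW // ln_gt0 // ltr1n.
have C10 : 0 <= C1 by rewrite addr_ge0 ?divr_ge0 ?mulr_ge0 // ltW.
have C20 : 0 <= C2 by rewrite divr_ge0 ?mulr_ge0 // ltW.
have C30 : 0 <= C3 by rewrite divr_ge0 ?mulr_ge0 // ltW.
have C0 : 0 <= 7 * (13 * C1 + 80 * C2 + 8 * C3) by lra.
have sb0 m (T : nat) : (2 < n)%N -> 0 <= space_bound n m T eps alpha beta K.
  move=> n3; have lnn := ln_nat_ge3 R n3; have lnl := lnln_nat_ge3 R n3.
  have ln3 := ln3_gt1 R.
  apply: mulr_ge0; first by rewrite divr_ge0 ?sqr_ge0 // ltW.
  apply: addr_ge0; last by rewrite divr_ge0 ?mulr_ge0.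
  apply: mulr_ge0; last by apply: le_trans lnl; exact: ltW.
  by rewrite mulr_ge0 // exprn_ge0 //; lra.
have n3P (G : rel 'I_n) : (0 < #|triangles G|)%N -> (2 < n)%N.
  move=> /card_gt0P[t]; rewrite inE => /andP[/eqP <- _].
  by apply: leq_trans (max_card _) _; rewrite card_ord.
(* With fewer than three vertices there is no triangle and the claim is vacuous. *)
have [n3|n_small] := boolP (2 < n)%N; last first.
  exists (const_alg n 0) => G sigma adj _ _ T0.
  by rewrite (n3P _ T0) in n_small.
pose delta := Num.sqrt K * eps.
have delta0 : 0 < delta by rewrite mulr_gt0 ?sqrtr_gt0.
have delta2 : delta ^+ 2 = K * eps ^+ 2 by rewrite exprMn sqr_sqrtr // ltW.
(* For [delta >= c - 1] the number [Tapx] is accurate enough; the lower side uses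
   [1 - delta <= 2 - c <= c^-1]. *)
have [coarse|fine_delta] := leP (c - 1) delta.
  exists (const_alg n Tapx) => G sigma adj sG oG T0 /andP[Tlo Thi] d Omega P p orc.
  have T0' : 0 < #|triangles G|%:R :> R by rewrite ltr0n.
  split=> [w cs|]; first by rewrite const_alg_space mulr_ge0 // sb0.
  rewrite const_alg_prob; first by rewrite lee_fin; lra.
  rewrite /approximates -/delta; apply/andP; split.
    apply: le_trans Tlo; rewrite mulrC ler_pM2l //.
    by rewrite -[leRHS]mul1r ler_pdivlMr //; nra.
  by apply: le_trans Thi _; rewrite ler_pM2r //; lra.
(* As [T] is known up to [c], [a * T] lies between [s / c] and [s * c]: the factor [c] in [s]
   secures [aT_ge], and [Q] uses the upper end. *)
pose s := 60 * q * c / eps ^+ 2.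
pose a := s / Tapx.
pose Q := 1 + 40 * (K + 1) * alpha * (depth n)%:R ^+ 2 * (s * c).
exists (alg a beta (8 + 2 * Q) (2 * base_rate (depth n) a beta) n3).
move=> G sigma adj sG oG T0 /andP[Tlo Thi] d Omega P p orc.
set T : R := #|triangles G|%:R in Tlo Thi *.
have {}T0 : 0 < T by rewrite ltr0n.
have Tapx0 : 0 < Tapx by apply: lt_le_trans Tlo; rewrite divr_gt0.
have e20 : 0 < eps ^+ 2 by rewrite exprn_gt0.
have s0 : 0 < s by rewrite divr_gt0 ?mulr_gt0.
have a0 : 0 < a by rewrite divr_gt0.
have ab0 : 0 <= a * beta by apply: mulr_ge0 => //; exact: ltW.
have sc0 : 0 < s * c by exact: mulr_gt0.
have K1 : K + 1 <= q * K.
  by rewrite /q mulrDl mul1r lerD2l mulrC ler_pdivlMr // mul1r.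
have aT_le : a * T <= s * c.
  rewrite /a mulrAC ler_pdivrMr // -(mulrA s c) ler_pM2l // (mulrC c).
  by move: Tlo; rewrite ler_pdivrMr.
have aT_ge : 60 * (K + 1) <= a * delta ^+ 2 * T.
  apply: le_trans (_ : 60 * (q * K) <= _); first by rewrite ler_pM2l.
  have -> : a * delta ^+ 2 * T = s * (K * eps ^+ 2) * (T / Tapx).
    by rewrite /a delta2; ring.
  have -> : 60 * (q * K) = s * (K * eps ^+ 2) * c^-1.
    by rewrite /s; field; rewrite !gt_eqF.
  have sK : 0 < s * (K * eps ^+ 2) by apply: mulr_gt0 => //; exact: mulr_gt0.
  rewrite (ler_pM2l sK) ler_pdivlMr // mulrC ler_pdivrMr //.
  by rewrite [leRHS]mulrC.
have J2 : 0 <= (depth n)%:R ^+ 2 :> R by rewrite sqr_ge0.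
have QT : 1 + 40 * (K + 1) * alpha * a * (depth n)%:R ^+ 2 * T <= Q.
  rewrite lerD2l.
  have -> : 40 * (K + 1) * alpha * a * (depth n)%:R ^+ 2 * T =
    40 * (K + 1) * alpha * (depth n)%:R ^+ 2 * (a * T) by ring.
  by rewrite ler_wpM2l // !mulr_ge0 // addr_ge0 // ltW.
split; last first.
  exact: (alg_success n3 sG oG orc alpha0 beta0 K_gt0 a0 delta0 T0 aT_ge QT).
move=> w cs; set st := adj_stream sigma adj in cs *.
have Q0 : 0 <= Q.
  rewrite addr_ge0 //; apply: mulr_ge0; last exact: ltW.
  by rewrite !mulr_ge0 // addr_ge0 // ltW.
have base0 : 0 <= base_rate (depth n) a beta.
  by apply: addr_ge0; [exact: mulr_ge0 | rewrite ltW ?rate_gt0].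
have B0 : 0 <= 8 + 2 * Q by rewrite addr_ge0 // mulr_ge0.
have gam0 : 0 <= 2 * base_rate (depth n) a beta by exact: mulr_ge0.
have := @alg_space R n a beta (8 + 2 * Q) (2 * base_rate (depth n) a beta) n3
  (fun e => p e w) st cs B0 gam0 (size_stream_sqr oG).
move/le_trans; apply.
set m : R := #|edges G|%:R.
have m0 : 0 <= m by [].
have st_m : (size st)%:R <= 2 * m.
  by rewrite /m -natrM ler_nat (size_stream_edges sG oG).
have rate_st : rate R (depth n) * (size st)%:R <= 1.
  rewrite mulrC /rate exprVn ler_pdivrMr ?exprn_gt0 // mul1r -natrX ler_nat.
  exact: leq_trans (size_stream_sqr oG) (sqr_le_coins n).
have [_ L1 depthL] := log_factor R n3.
set L := ln n%:R ^+ 3 * ln (ln n%:R) in L1 depthL.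
rewrite -/l3 -/g in L1 depthL.
pose k := K / eps ^+ 2.
have k0 : 0 < k by rewrite divr_gt0.
have e2le : eps ^+ 2 <= 1 by rewrite exprn_ile1 // ltW.
have Kk : K <= k by rewrite /k ler_pdivlMr // ler_piMr // ltW.
(* In the remaining case [delta < c - 1], so [K * eps ^+ 2 <= c ^+ 2]; this trades one factor [K]
   for [c ^+ 2 / eps ^+ 2]. *)
have K2k : K ^+ 2 <= c ^+ 2 * k.
  rewrite /k mulrA ler_pdivlMr // expr2 -mulrA -delta2 mulrC ler_pM2r //.
  rewrite lerXn2r ?nnegrE ?ltW //; lra.
pose X := k * (alpha * L); pose Y := k * (m * beta / T).
have SXY : space_bound n #|edges G| #|triangles G| eps alpha beta K = X + Y.
  by rewrite /space_bound /X /Y /k /L -mulrDr !mulrA.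
have ka : k * alpha <= X / l3.
  have -> : X / l3 = k * alpha * (L / l3) by rewrite /X; ring.
  by rewrite ler_peMr // mulr_ge0 // ltW.
have ka0 : 0 <= k * alpha by apply: mulr_ge0 => //; exact: ltW.
have X0 : 0 <= X.
  move: ka; rewrite ler_pdivlMr //; apply: le_trans; apply: mulr_ge0 => //; exact: ltW.
have mbT : 0 <= m * beta / T by rewrite divr_ge0 ?mulr_ge0 // ltW.
have Y0 : 0 <= Y by apply: mulr_ge0 => //; exact: ltW.
have XE : X = k * (alpha * L) by [].
have YE : Y = k * (m * beta / T) by [].
clearbody X Y.
(* The constant 1 is bounded through [oracle_space_lower] at [lam = 3 * q * K], which exceeds both 1
   and [2 * K]. *)
have H1 : 1 <= C1 * (X + Y).
  have lamK : K + 1 < 3 * q * K by move: K1; lra.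
  have lam1 : 1 <= 3 * q * K by lra.
  have lam2 : 2 * K < 3 * q * K by move: K1; lra.
  have := oracle_space_lower sG oG orc beta0 K_gt0 lam1 lam2.
  rewrite -/T -/m -[leLHS]mul1r -ler_pdivlMr // => /le_trans; apply.
  have -> : ((3 * q * K) ^+ 2 * alpha * T + 2 * (3 * q * K) * beta * m) / T =
      9 * q ^+ 2 * alpha * K ^+ 2 + 6 * q * (m * beta / T) * K.
    by field; rewrite gt_eqF.
  apply: le_trans (_ : 9 * q ^+ 2 * c ^+ 2 / l3 * X + 6 * q * Y <= _); last first.
    have -> : C1 * (X + Y) = 9 * q ^+ 2 * c ^+ 2 / l3 * X + 6 * q * Y +
        (9 * q ^+ 2 * c ^+ 2 / l3 * Y + 6 * q * X) by rewrite /C1; ring.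
    have u0 : 0 <= 9 * q ^+ 2 * c ^+ 2 / l3.
      by rewrite divr_ge0 // ?mulr_ge0 ?sqr_ge0 // ltW.
    have v0 : 0 <= 6 * q by apply: mulr_ge0 => //; exact: ltW.
    by rewrite lerDl; apply: addr_ge0; apply: mulr_ge0.
  rewrite lerD //.
    have -> : 9 * q ^+ 2 * c ^+ 2 / l3 * X = 9 * q ^+ 2 * (c ^+ 2 * (X / l3)) by ring.
    have -> : 9 * q ^+ 2 * alpha * K ^+ 2 = 9 * q ^+ 2 * (alpha * K ^+ 2) by ring.
    apply: ler_wpM2l; first by apply: mulr_ge0 => //; exact: sqr_ge0.
    apply: le_trans (_ : c ^+ 2 * (k * alpha) <= _).
      by rewrite mulrA mulrC; apply: ler_wpM2r.
    by apply: ler_wpM2l => //; exact: sqr_ge0.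
  have -> : 6 * q * Y = 6 * q * (m * beta / T) * k by rewrite YE; ring.
  apply: ler_wpM2l => //.
  by apply: mulr_ge0 => //; apply: mulr_ge0 => //; exact: ltW.
have H2 : (K + 1) * alpha * (depth n)%:R ^+ 2 * (s * c) <= C2 * (X + Y).
  apply: le_trans (_ : C2 * X <= _); last first.
    by rewrite ler_wpM2l // lerDl.
  apply: le_trans (_ : q * K * alpha * (g ^+ 2 * (L / l3)) * (s * c) <= _).
    rewrite (ler_pM2r sc0) ler_pM // ?mulr_ge0 ?addr_ge0 //; try exact: ltW.
    by rewrite ler_wpM2r.
  rewrite le_eqVlt; apply/orP; left; apply/eqP; rewrite /C2 XE /k /s; field.
  by rewrite !gt_eqF.
have H3 : a * beta * m <= C3 * (X + Y).
  apply: le_trans (_ : C3 * Y <= _); last first.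
    by rewrite ler_wpM2l // lerDr.
  apply: le_trans (_ : s * c * (m * beta / T) <= _).
    have -> : a * beta * m = a * T * (m * beta / T) by field; rewrite gt_eqF.
    by rewrite ler_wpM2r.
  have -> : C3 * Y = s * c * (m * beta / T) * (K / K0).
    by rewrite /C3 YE /k /s; field; rewrite !gt_eqF.
  rewrite ler_peMr //; first by apply: mulr_ge0 => //; exact: ltW.
  by rewrite ler_pdivlMr // mul1r.
have H4 : 2 * base_rate (depth n) a beta * (size st)%:R <= 8 * (a * beta * m) + 2.
  have -> : 2 * base_rate (depth n) a beta * (size st)%:R =
      4 * (a * beta) * (size st)%:R + 2 * (rate R (depth n) * (size st)%:R).
    by rewrite /base_rate; ring.
  have : a * beta * (size st)%:R <= a * beta * (2 * m).
    by rewrite ler_wpM2l.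
  by lra.
have QE : Q = 1 + 40 * ((K + 1) * alpha * (depth n)%:R ^+ 2 * (s * c)).
  by rewrite /Q; ring.
rewrite SXY.
(* Each cell takes 7 words; the additive constants are 1 for the counter, 8 + 2 from the cap and 2
   from the lowest rate, 13 in all. *)
have -> : 7 * (13 * C1 + 80 * C2 + 8 * C3) * (X + Y) =
    7 * (13 * (C1 * (X + Y)) + 80 * (C2 * (X + Y)) + 8 * (C3 * (X + Y))) by ring.
rewrite QE; move: H1 H2 H3 H4.
set u1 := C1 * _; set u2 := C2 * _; set u3 := C3 * _.
set v2 := (K + 1) * _ * _ * _; set v3 := a * beta * m; set v4 := _ * (size st)%:R.
by lra.
Qed.
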